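(* Let $c\in(0,1)$ be fixed and let $S=S(n)$ be graphs on vertex set $[n]$ such that (i) $\operatorname{rng}(S)=o(\Delta(S)/\log n)$; (ii) $\bigl\|A(S)-\tfrac{|S|}{N}J\bigr\|_2\le c\,\Delta(S)$; (iii) for any fixed $\delta>0$, we have $$\sum_{(j,k)\,:\,jk\in S}x_jy_k=(1+o(1))\,\|\boldsymbol{x}\|_1\|\boldsymbol{y}\|_1\,\frac{\Delta(S)}{n}$$ uniformly over all $\boldsymbol{x},\boldsymbol{y}\in[0,1]^n$ with $\|\boldsymbol{x}\|_1,\|\boldsymbol{y}\|_1\ge\delta n$. Let $\boldsymbol{t}=\boldsymbol{t}(n)\in\mathbb{N}^n$ be degree sequences such that the set of $\boldsymbol{t}$-factors of $S$ is non-empty and (iv) $\operatorname{rng}(\boldsymbol{t})=o(\Delta(\boldsymbol{t})/\log n)$ and $\dfrac{\log^2 n}{\Delta(S)}\ll\Delta(\boldsymbol{t})\ll\dfrac{\Delta(S)}{\log n}$. Then, uniformly over $jk\in S$, $$\Pr(jk\in S_{\boldsymbol{t}})=(1+o(1))\frac{\Delta(\boldsymbol{t})}{\Delta(S)}.$$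
   Context: All asymptotics are as $n\to\infty$; $a_n\ll b_n$ means $a_n=o(b_n)$. Graphs are simple. For a graph $G$ on $[n]$: $A(G)$ is its adjacency matrix, $|G|$ its number of edges, $jk\in G$ means that $jk$ is an edge of $G$, $\Delta(G)$ is its maximum degree, and $\operatorname{rng}(G)$ is its maximum degree minus its minimum degree. For a vector $\boldsymbol{t}$, $\Delta(\boldsymbol{t})$ is its maximum component and $\operatorname{rng}(\boldsymbol{t})$ is its maximum component minus its minimum component. $N=\binom n2$, $J$ is the $n\times n$ all-ones matrix, $\|\cdot\|_2$ of a matrix is the operator norm induced by the Euclidean norm, and $\|\boldsymbol{x}\|_1=\sum_i|x_i|$. The sum in (iii) is over ordered pairs $(j,k)$ such that $jk$ is an edge of $S$. A $\boldsymbol{t}$-factor of $S$ is a spanning subgraph of $S$ with degree sequence $\boldsymbol{t}$; $S_{\boldsymbol{t}}$ denotes a uniformly random $\boldsymbol{t}$-factor of $S$. *)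

(* Defs.v *)
From HB Require Import structures.
From mathcomp Require Import all_boot all_order all_algebra.
From mathcomp Require Import all_classical all_reals all_analysis.

Set Implicit Arguments.
Unset Strict Implicit.
Unset Printing Implicit Defensive.

Import Order.TTheory GRing.Theory Num.Theory.
Import numFieldNormedType.Exports.

Local Open Scope ring_scope.

Definition is_edge_set (n : nat) (E : {set {set 'I_n}}) : bool :=
  [forall e in E, #|e| == 2]%N.

Record sgraph (n : nat) : predArgType :=
  SGraph { edges : {set {set 'I_n}}; edgesP : is_edge_set edges }.

HB.instance Definition _ (n : nat) := [isSub for @edges n].
HB.instance Definition _ (n : nat) := [Finite of sgraph n by <:].

(* If j = k then [set j; k] is a singleton, hence not an edge. *)
Definition adj (n : nat) (G : sgraph n) (j k : 'I_n) : bool :=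
  ([set j; k] \in edges G)%SET.

Definition nb_edges (n : nat) (G : sgraph n) : nat := #|edges G|.

Definition deg (n : nat) (G : sgraph n) (j : 'I_n) : nat := #|adj G j|.

Definition adjmx (R : realType) (n : nat) (G : sgraph n) : 'M[R]_n :=
  \matrix_(j, k) (adj G j k)%:R.

Definition vmax (n : nat) (t : 'I_n -> nat) : nat := (\max_(i < n) t i)%N.

(* The neutral element is an upper bound of the components, so for n > 0 it does
   not affect the minimum. *)
Definition vmin (n : nat) (t : 'I_n -> nat) : nat :=
  \big[minn/vmax t]_(i < n) t i.

Definition vrng (n : nat) (t : 'I_n -> nat) : nat := (vmax t - vmin t)%N.

Definition gmax (n : nat) (G : sgraph n) : nat := vmax (deg G).

Definition grng (n : nat) (G : sgraph n) : nat := vrng (deg G).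

Definition l1norm (R : realType) (n : nat) (x : 'cV[R]_n) : R :=
  \sum_i `|x i 0|.

Definition l2norm (R : realType) (n : nat) (x : 'cV[R]_n) : R :=
  Num.sqrt (\sum_i x i 0 ^+ 2).

(* The library norm on matrices is the entrywise sup norm.  The set below is
   nonempty and, the dimension being finite, bounded: [sup] is a true supremum. *)
Definition opnorm2 (R : realType) (n : nat) (A : 'M[R]_n) : R :=
  sup [set l2norm (A *m x) | x in [set x : 'cV[R]_n | l2norm x <= 1]]%classic.

Definition is_factor (n : nat) (S : sgraph n) (t : 'I_n -> nat)
    (H : sgraph n) : bool :=
  (edges H \subset edges S) && [forall j, deg H j == t j].

Definition factors (n : nat) (S : sgraph n) (t : 'I_n -> nat) :
    {set sgraph n} :=
  [set H | is_factor S t H]%SET.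

Definition unif_pr (R : realType) (T : finType) (A : {set T}) (P : pred T) : R :=
  #|[set x in A | P x]%SET|%:R / #|A|%:R.

(* Main.v *)
Require Import Defs.
From mathcomp Require Import all_boot all_order all_algebra.
From mathcomp Require Import all_classical all_reals all_analysis.
From mathcomp Require Import ring lra zify.

Set Implicit Arguments.
Unset Strict Implicit.
Unset Printing Implicit Defensive.

Import Order.TTheory GRing.Theory Num.Theory.
Import numFieldNormedType.Exports.

Local Open Scope ring_scope.

(** Edge switching along long alternating closed trails.  Write D and d for the
    maximum degrees of S and t.  Fix an edge jk of S and call a step of a walk
    red (type [true]) if it uses an edge of the current factor H, and blue (type
    [false]) if it uses an edge of S outside H.  A closed walk of even length
    through jk whose steps alternate between red and blue and whose edges are
    distinct can be switched: exchanging the two colours along it yields another t-factor, in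
    which jk has changed its colour, and switching the same trail again
    restores H.  So, summed over all t-factors, there are as many such trails
    with jk red as with jk blue ([double_count_switch]).

    It remains to count, for a single factor H, the trails that complete jk.
    They are walks with an odd number m of steps from k to j.  A blue step has
    about D choices and a red one about d, so a walk whose end is unconstrained
    has about D^((m+1)/2) d^((m-1)/2) choices if it starts with a blue step,
    which is the case when jk is red, and D^((m-1)/2) d^((m+1)/2) choices if jk
    is blue.  If m is a large multiple of ln n, a proportion 1/n of these walks
    ends at j, and almost all of the latter have distinct edges
    ([count_switchable]).  Comparing the two counts, the numbers N1 and N0 of
    factors with jk red and blue satisfy N1 D ~ N0 d, and d = o(D) gives the
    probability d / D.

    The proportion 1/n comes from mixing ([altmx_mixing]).  Start from a vertex,
    divide each step by its maximal number of choices, and compare the resulting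
    weight vector with a constant vector.  Its total weight is 1 up to a factor
    (1 - o(1/ln n))^m = 1 - o(1), by near-regularity of S and t.  Its Euclidean
    distance to the constants is contracted by a factor close to c at each blue
    step, by the spectral hypothesis and d = o(D), and is not increased by a red
    step, whatever H is; both hold up to an error o(1 / (sqrt n ln n)) caused by
    the remaining irregularity.  After O(ln n) steps it is o(1/sqrt n).
    Cutting a walk in the middle writes the number of walks between two given
    vertices as the inner product of a forward and a backward weight vector, so
    that this Euclidean estimate yields an estimate for every pair of endpoints.

    Walks with a repeated edge are counted by a union bound over the two
    positions of that edge ([wsum_trail_ge]).  The positions cut the walk into
    three segments, one of which is long enough to mix and supplies the factor
    1/n.  The repetition fixes an edge, which costs a factor 1/d or 1/D, and
    forces a short segment to close up, which costs a further factor; together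
    they are at most 1/(dD) for each direction of the repetition.  The m^2 pairs
    of positions then contribute a proportion O(ln^2 n / (dD)) = o(1). *)

(** * Euclidean norm and operator norm *)

Section EuclideanNorm.
Variables (R : realType) (n : nat).
Implicit Types (x y z : 'cV[R]_n) (A : 'M[R]_n).

Definition dot x y : R := \sum_i x i 0 * y i 0.

Lemma l2norm_ge0 x : 0 <= l2norm x.
Proof. exact: sqrtr_ge0. Qed.

Lemma sqr_l2norm x : l2norm x ^+ 2 = \sum_i x i 0 ^+ 2.
Proof. by rewrite sqr_sqrtr// sumr_ge0// => i _; rewrite sqr_ge0. Qed.

Lemma l2norm_le x (b : R) : 0 <= b -> \sum_i x i 0 ^+ 2 <= b ^+ 2 -> l2norm x <= b.
Proof.
by move=> b0; rewrite -sqr_l2norm ler_pXn2r// nnegrE ?l2norm_ge0.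
Qed.

Lemma sum_CauchySchwarz (I : finType) (f g : I -> R) :
  (\sum_i f i * g i) ^+ 2 <= (\sum_i f i ^+ 2) * (\sum_i g i ^+ 2).
Proof.
set a := \sum_i f i ^+ 2; set b := \sum_i g i ^+ 2; set p := \sum_i _ * _.
have a0 : 0 <= a by apply: sumr_ge0 => i _; exact: sqr_ge0.
have h s t : 0 <= s ^+ 2 * a - 2 * s * t * p + t ^+ 2 * b.
  (* the quadratic form of the Gram matrix is a sum of squares *)
  suff -> : s ^+ 2 * a - 2 * s * t * p + t ^+ 2 * b = \sum_i (s * f i - t * g i) ^+ 2.
    by apply: sumr_ge0 => i _; exact: sqr_ge0.
  rewrite /a /b /p !mulr_sumr -sumrB -big_split/=.
  by apply: eq_bigr => i _; ring.
have [a_eq0|a_neq0] := eqVneq a 0.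
  have fi0 i : f i = 0.
    move/eqP: a_eq0; rewrite psumr_eq0 => [|? _]; last exact: sqr_ge0.
    by move=> /allP /(_ i); rewrite mem_index_enum sqrf_eq0 => /(_ isT)/eqP.
  by rewrite a_eq0 mul0r /p big1 ?expr0n// => i _; rewrite fi0 mul0r.
(* the choice of s and t that turns the form into a multiple of the discriminant *)
have := h p a.
have -> : p ^+ 2 * a - 2 * p * a * p + a ^+ 2 * b = a * (a * b - p ^+ 2) by ring.
by rewrite pmulr_rge0 ?lt_def ?a_neq0// subr_ge0.
Qed.

Lemma dot_le x y : `|dot x y| <= l2norm x * l2norm y.
Proof.
rewrite -(@ler_pXn2r _ 2)// ?nnegrE ?mulr_ge0 ?l2norm_ge0//.
by rewrite real_normK ?num_real// exprMn !sqr_l2norm sum_CauchySchwarz.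
Qed.

Lemma l2normD x y : l2norm (x + y) <= l2norm x + l2norm y.
Proof.
apply: l2norm_le; first by rewrite addr_ge0 ?l2norm_ge0.
have -> : \sum_i (x + y) i 0 ^+ 2
    = l2norm x ^+ 2 + l2norm y ^+ 2 + 2 * dot x y.
  rewrite !sqr_l2norm mulr_sumr -!big_split/=.
  by apply: eq_bigr => i _; rewrite mxE; ring.
have := le_trans (ler_norm _) (dot_le x y); nra.
Qed.

Lemma l2normZ (a : R) x : l2norm (a *: x) = `|a| * l2norm x.
Proof.
apply/eqP; rewrite -(@eqrXn2 _ 2)// ?mulr_ge0 ?l2norm_ge0//; apply/eqP.
rewrite exprMn real_normK ?num_real// !sqr_l2norm mulr_sumr.
by apply: eq_bigr => i _; rewrite mxE exprMn.
Qed.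

Lemma l2norm0 : l2norm (0 : 'cV[R]_n) = 0.
Proof. by have := l2normZ 0 0; rewrite scale0r normr0 mul0r. Qed.

Lemma l2norm_eq0 x : l2norm x = 0 -> x = 0.
Proof.
move=> /(congr1 (fun a => a ^+ 2)); rewrite sqr_l2norm expr0n/= => /eqP.
rewrite psumr_eq0 => [|? _]; last exact: sqr_ge0.
move=> /allP h; apply/matrixP => i j; rewrite ord1 mxE.
by have := h i; rewrite mem_index_enum sqrf_eq0 => /(_ isT)/eqP.
Qed.

Lemma coord_le_l2norm x i : `|x i 0| <= l2norm x.
Proof.
rewrite -(@ler_pXn2r _ 2)// ?nnegrE ?l2norm_ge0//.
rewrite real_normK ?num_real// sqr_l2norm (bigD1 i)//= lerDl.
by apply: sumr_ge0 => k _; exact: sqr_ge0.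
Qed.

(** Makes the set in the definition of [opnorm2] bounded, so that its supremum is
    an upper bound. *)
Lemma l2norm_bounded A : exists b : R, forall x, l2norm x <= 1 -> l2norm (A *m x) <= b.
Proof.
exists (Num.sqrt (\sum_i (\sum_k `|A i k|) ^+ 2)) => x x1.
apply: l2norm_le; first exact: sqrtr_ge0.
rewrite sqr_sqrtr; last by apply: sumr_ge0 => k _; exact: sqr_ge0.
apply: ler_sum => i _; rewrite -[leLHS]real_normK ?num_real//.
rewrite ler_pXn2r// ?nnegrE ?sumr_ge0// mxE.
apply: le_trans (ler_norm_sum _ _ _) _; apply: ler_sum => k _.
by rewrite normrM ler_piMr// (le_trans (coord_le_l2norm _ _)).
Qed.

Lemma l2norm_mulmx_le A x : l2norm (A *m x) <= opnorm2 A * l2norm x.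
Proof.
have [x0|x0] := eqVneq (l2norm x) 0.
  by rewrite (l2norm_eq0 x0) mulmx0 l2norm0 mulr0.
have xp : 0 < l2norm x by rewrite lt_def x0 l2norm_ge0.
rewrite -ler_pdivrMr//.
have -> : l2norm (A *m x) / l2norm x = l2norm (A *m ((l2norm x)^-1 *: x)).
  by rewrite -scalemxAr l2normZ ger0_norm ?invr_ge0 ?l2norm_ge0// mulrC.
have [b hb] := l2norm_bounded A.
apply: ub_le_sup.
  by exists b => _ [y /= y1 <-]; exact: hb.
exists ((l2norm x)^-1 *: x) => //=.
by rewrite l2normZ ger0_norm ?invr_ge0 ?l2norm_ge0// mulVf.
Qed.

(** Schur test: Cauchy-Schwarz for each row with the weights [A i k], then the
    column sums after exchanging the order of summation. *)
Lemma l2norm_schur A (b : R) x : 0 <= b -> (forall i k, 0 <= A i k) ->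
    (forall i, \sum_k A i k <= b) -> (forall k, \sum_i A i k <= b) ->
  l2norm (A *m x) <= b * l2norm x.
Proof.
move=> b0 A0 Ar Ac; apply: l2norm_le; first by rewrite mulr_ge0 ?l2norm_ge0.
have row i : (A *m x) i 0 ^+ 2 <= b * \sum_k A i k * x k 0 ^+ 2.
  rewrite mxE.
  have -> : \sum_k A i k * x k 0
      = \sum_k Num.sqrt (A i k) * (Num.sqrt (A i k) * x k 0).
    by apply: eq_bigr => k _; rewrite mulrA -expr2 sqr_sqrtr.
  apply: le_trans (sum_CauchySchwarz _ _) _.
  under eq_bigr do rewrite sqr_sqrtr//.
  under [X in _ * X]eq_bigr do rewrite exprMn sqr_sqrtr//.
  apply: ler_wpM2r; last exact: Ar.
  by apply: sumr_ge0 => k _; rewrite mulr_ge0 ?sqr_ge0.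
apply: le_trans (ler_sum _ (fun i _ => row i)) _.
rewrite -mulr_sumr exchange_big/= exprMn sqr_l2norm [in leRHS]expr2 -mulrA.
apply: ler_wpM2l => //; rewrite mulr_sumr; apply: ler_sum => k _.
by rewrite -mulr_suml ler_wpM2r ?sqr_ge0.
Qed.

End EuclideanNorm.

(** * Mixing of alternating products *)

(** When [N tau] is the adjacency matrix of the steps of type [tau] divided by
    their maximum degree, the entry (x, y) is the number of walks from x to y with
    m steps of alternating types, divided by the trivial upper bound for the
    number of such walks from x. *)
Fixpoint altmx {R : pzRingType} {n : nat} (N : bool -> 'M[R]_n) (tau : bool) (m : nat) : 'M[R]_n :=
  if m is m'.+1 then N tau *m altmx N (~~ tau) m' else 1%:M.

Section AltmxAlgebra.
Variables (R : comNzRingType) (n : nat) (N : bool -> 'M[R]_n).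
Local Notation W := (altmx N).

Lemma altmxD tau a b : W tau (a + b) = W tau a *m W (tau (+) odd a) b.
Proof.
elim: a tau => [|a IH] tau; first by rewrite add0n mul1mx addbF.
by rewrite addSn /= IH mulmxA; case: tau; case: (odd a).
Qed.

Lemma altmx1 tau : W tau 1 = N tau.
Proof. by rewrite /= mulmx1. Qed.

(** Reversal of walks: the reversed walk starts with the last type. *)
Lemma altmx_tr tau m : (forall tau, (N tau)^T = N tau) ->
  (W tau m)^T = W (~~ tau (+) odd m) m.
Proof.
move=> Nsym; elim: m tau => [|m IH] tau; first by rewrite trmx1.
rewrite [in LHS]/= trmx_mul IH negbK Nsym -[in RHS](addn1 m) altmxD altmx1 addn1.
by rewrite /=; case: tau; case: (odd m).
Qed.

End AltmxAlgebra.

Section Substochastic.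
Variables (R : realType) (n : nat) (N : bool -> 'M[R]_n).
Hypothesis N_ge0 : forall tau x y, 0 <= N tau x y.
Hypothesis N_sym : forall tau, (N tau)^T = N tau.
Hypothesis N_row : forall tau x, \sum_y N tau x y <= 1.
Local Notation W := (altmx N).

Lemma altmx_ge0 tau m x y : 0 <= W tau m x y.
Proof.
elim: m tau x => [|m IH] tau x /=; first by rewrite mxE ler0n.
by rewrite mxE sumr_ge0// => z _; rewrite mulr_ge0.
Qed.

Lemma altmx_sym tau m x y : W tau m x y = W (~~ tau (+) odd m) m y x.
Proof. by rewrite -altmx_tr// mxE. Qed.

Lemma sum_altmxS tau m x :
  \sum_y W tau m.+1 x y = \sum_z N tau x z * \sum_y W (~~ tau) m z y.
Proof.
under eq_bigr do rewrite /= mxE.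
by rewrite exchange_big/=; apply: eq_bigr => z _; rewrite mulr_sumr.
Qed.

Lemma sum_altmx0 x : \sum_y (1%:M : 'M[R]_n) x y = 1.
Proof.
rewrite (bigD1 x)//= big1 => [|y /negPf yx]; first by rewrite addr0 mxE eqxx.
by rewrite mxE eq_sym yx.
Qed.

Lemma altmx_row_le1 tau m x : \sum_y W tau m x y <= 1.
Proof.
elim: m tau x => [|m IH] tau x; first by rewrite sum_altmx0.
rewrite sum_altmxS (le_trans _ (N_row tau x))//.
by apply: ler_sum => z _; rewrite ler_piMr.
Qed.

Lemma altmx_col_le1 tau m y : \sum_x W tau m x y <= 1.
Proof.
under eq_bigr do rewrite altmx_sym.
exact: altmx_row_le1.
Qed.

Lemma altmx_row_ge (eta : R) tau m x : 0 <= eta ->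
    (forall tau x, 1 - eta <= \sum_y N tau x y) ->
  1 - m%:R * eta <= \sum_y W tau m x y.
Proof.
move=> eta0 Nlow; elim: m tau x => [|m IH] tau x.
  by rewrite sum_altmx0 mul0r subr0.
have [neg|pos] := ltP (1 - m%:R * eta) 0.
  apply: (@le_trans _ _ 0); last by apply: sumr_ge0 => y _; exact: altmx_ge0.
  by rewrite -natr1; lra.
rewrite sum_altmxS.
apply: (@le_trans _ _ (\sum_z N tau x z * (1 - m%:R * eta))); last first.
  by apply: ler_sum => z _; rewrite ler_wpM2l.
rewrite -mulr_suml; apply: le_trans (ler_wpM2r pos (Nlow tau x)).
rewrite -natr1.
have : 0 <= m%:R * eta * eta by rewrite !mulr_ge0.
lra.
Qed.

(** An upper bound on all entries persists for longer products, because the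
    additional factors in front have row sums at most 1. *)
Lemma altmx_uniform_le (kappa : R) m0 tau m x y :
    (forall tau x y, W tau m0 x y <= kappa) -> (m0 <= m)%N ->
  W tau m x y <= kappa.
Proof.
move=> h /subnK <-; rewrite altmxD mxE.
have k0 : 0 <= kappa := le_trans (altmx_ge0 tau m0 x y) (h _ _ _).
apply: (@le_trans _ _ (\sum_z W tau (m - m0) x z * kappa)).
  by apply: ler_sum => z _; rewrite ler_wpM2l// altmx_ge0.
by rewrite -mulr_suml ler_piMl// altmx_row_le1.
Qed.

End Substochastic.

(** A lower bound persists up to the mass lost by the additional factors. *)
Lemma altmx_uniform_ge (R : realType) n (N : bool -> 'M[R]_n) (eta kappa : R) m0 tau m x y :
    (forall tau x y, 0 <= N tau x y) -> 0 <= eta ->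
    (forall tau x, 1 - eta <= \sum_y N tau x y) -> 0 <= kappa ->
    (forall tau x y, kappa <= altmx N tau m0 x y) -> (m0 <= m)%N ->
  kappa * (1 - m%:R * eta) <= altmx N tau m x y.
Proof.
move=> N0 eta0 Nrow k0 h m0m.
apply: (@le_trans _ _ (\sum_z altmx N tau (m - m0) x z * kappa)).
  rewrite -mulr_suml mulrC ler_wpM2r//.
  apply: le_trans (altmx_row_ge N0 _ _ _ eta0 Nrow).
  by rewrite lerD2l lerN2 ler_wpM2r// ler_nat leq_subr.
rewrite -{2}(subnK m0m) altmxD mxE.
by apply: ler_sum => z _; rewrite ler_wpM2l// altmx_ge0.
Qed.

(** Only the steps of type [false] (along S minus the factor) contract vectors of
    zero sum; the steps of type [true] belong to an arbitrary factor, and all that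
    is known about them is that they are almost doubly stochastic. *)
Section Mixing.
Variables (R : realType) (n : nat) (N : bool -> 'M[R]_n) (q eta : R).
Hypothesis N_ge0 : forall tau x y, 0 <= N tau x y.
Hypothesis N_sym : forall tau, (N tau)^T = N tau.
Hypothesis N_row : forall tau x, \sum_y N tau x y <= 1.
Hypothesis N_row_ge : forall tau x, 1 - eta <= \sum_y N tau x y.
Hypothesis eta_ge0 : 0 <= eta.
Hypothesis q_bound : 0 <= q < 1.
Hypothesis N_contract : forall z : 'cV[R]_n, \sum_i z i 0 = 0 ->
  l2norm (N false *m z) <= q * l2norm z.
Hypothesis n_gt0 : (0 < n)%N.
Local Notation W := (altmx N).
Local Notation s := (Num.sqrt (n%:R : R)).

Definition mean (f : 'cV[R]_n) : R := (\sum_i f i 0) / n%:R.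
Definition dev (f : 'cV[R]_n) : 'cV[R]_n := f - const_mx (mean f).

Let nR_gt0 : 0 < n%:R :> R. Proof. by rewrite ltr0n. Qed.
Let s_gt0 : 0 < s. Proof. by rewrite sqrtr_gt0. Qed.
Let s_sqr : s ^+ 2 = n%:R. Proof. by rewrite sqr_sqrtr// ltW. Qed.

Let invn : n%:R^-1 = s^-1 * s^-1. Proof. by rewrite -invfM -expr2 s_sqr. Qed.

Implicit Type f : 'cV[R]_n.

Lemma sum_const (a : R) : \sum_(i < n) a = n%:R * a.
Proof. by rewrite sumr_const card_ord mulr_natl. Qed.

Lemma sum_mean f : \sum_i f i 0 = n%:R * mean f.
Proof. by rewrite /mean mulrC divfK// gt_eqF. Qed.

Lemma sum_dev f : \sum_i dev f i 0 = 0.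
Proof.
under eq_bigr do rewrite !mxE.
by rewrite sumrB sum_const sum_mean subrr.
Qed.

(** [dev f] is the orthogonal projection of f away from the constants. *)
Lemma l2norm_dev_min f (a : R) : l2norm (dev f) <= l2norm (f - const_mx a).
Proof.
apply: l2norm_le; first exact: l2norm_ge0.
rewrite sqr_l2norm.
have -> : \sum_i (f - const_mx a) i 0 ^+ 2
  = \sum_i dev f i 0 ^+ 2 + (\sum_i dev f i 0 * (2 * (mean f - a)) + \sum_(i < n) (mean f - a) ^+ 2).
  by rewrite -!big_split/=; apply: eq_bigr => i _; rewrite !mxE; ring.
rewrite -mulr_suml sum_dev mul0r add0r lerDl.
by apply: sumr_ge0 => i _; exact: sqr_ge0.
Qed.

(** Irregularity of the row sums moves the constant vector of height
    [mean f <= 1 / n] by at most [eta / n] in each coordinate, hence the additive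
    error [eta / sqrt n].  It is this small because the total mass of f is bounded
    by 1; the analogous estimate relative to [l2norm f] would be too weak. *)
Lemma dev_step tau (g : R) (f : 'cV[R]_n) :
    (forall i, 0 <= f i 0) -> \sum_i f i 0 <= 1 ->
    l2norm (N tau *m dev f) <= g * l2norm (dev f) ->
  l2norm (dev (N tau *m f)) <= eta / s + g * l2norm (dev f).
Proof.
move=> f0 f1 hg.
(* comparing with the old mean avoids computing the new one *)
apply: le_trans (l2norm_dev_min _ (mean f)) _.
have -> : N tau *m f - const_mx (mean f)
   = mean f *: (N tau *m const_mx 1 - const_mx 1) + N tau *m dev f.
  rewrite /dev mulmxBr scalerBr.
  have -> : (const_mx (mean f) : 'cV[R]_n) = mean f *: const_mx 1.
    by apply/matrixP => i j; rewrite !mxE mulr1.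
  by rewrite -scalemxAr [RHS]addrC addrA subrK.
apply: le_trans (l2normD _ _) _; apply: lerD => //.
have mean0 : 0 <= mean f by rewrite divr_ge0 ?sumr_ge0// ltW.
have mean1 : mean f <= n%:R^-1 by rewrite /mean ler_piMl// invr_ge0 ltW.
rewrite l2normZ ger0_norm//.
apply: (@le_trans _ _ (n%:R^-1 * (eta * s))); last first.
  by rewrite invn mulrCA -mulrA mulVf ?mulr1// gt_eqF.
apply: ler_pM => //; first exact: l2norm_ge0.
apply: l2norm_le; first by rewrite mulr_ge0// ltW.
rewrite exprMn s_sqr mulrC -sum_const; apply: ler_sum => i _.
rewrite -[leLHS]real_normK ?num_real// ler_pXn2r ?nnegrE//.
rewrite !mxE.
have -> : \sum_j N tau i j * (const_mx 1 : 'cV[R]_n) j 0 = \sum_j N tau i j.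
  by apply: eq_bigr => j _; rewrite mxE mulr1.
have := N_row tau i; have := N_row_ge tau i; rewrite ler_norml; lra.
Qed.

(** One of any two consecutive steps contracts; the errors of [dev_step] add up
    to a geometric series of ratio q. *)
Lemma dev_col (r : nat) tau y :
  l2norm (dev (col y (W tau r.*2))) <= q ^+ r + 2 * eta / ((1 - q) * s).
Proof.
have [q0 q1] := andP q_bound.
have h1 : 0 < 1 - q by rewrite subr_gt0.
have es0 : 0 <= eta / s by rewrite divr_ge0// ltW.
elim: r tau => [|r IH] tau.
  apply: (@le_trans _ _ 1); last by rewrite expr0 lerDl divr_ge0// mulr_ge0// ltW.
  apply: le_trans (l2norm_dev_min _ 0) _.
  apply: l2norm_le => //; rewrite (bigD1 y)//= big1 => [|i /negPf iy].
    by rewrite !mxE eqxx addr0 subr0 !expr1n.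
  by rewrite !mxE iy subr0 expr0n.
have step tau' m (g : R) :
    (l2norm (N tau' *m dev (col y (W (~~ tau') m)))
       <= g * l2norm (dev (col y (W (~~ tau') m)))) ->
    l2norm (dev (col y (W tau' m.+1)))
      <= eta / s + g * l2norm (dev (col y (W (~~ tau') m))).
  move=> hg; rewrite /=.
  have -> : col y (N tau' *m W (~~ tau') m) = N tau' *m col y (W (~~ tau') m).
    by apply/matrixP => i k; rewrite !mxE; apply: eq_bigr => z _; rewrite mxE.
  apply: dev_step => //.
    by move=> i; rewrite mxE altmx_ge0.
  by under eq_bigr do rewrite mxE; exact: altmx_col_le1.
have contrF z : l2norm (N false *m dev z) <= q * l2norm (dev z).
  exact/N_contract/sum_dev.
have contrT z : l2norm (N true *m dev z) <= 1 * l2norm (dev z).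
  apply: l2norm_schur => // k.
  rewrite (eq_bigr (fun i => N true k i))// => i _.
  by rewrite -[in LHS]N_sym mxE.
have -> : q ^+ r.+1 + 2 * eta / ((1 - q) * s)
   = 2 * (eta / s) + q * (q ^+ r + 2 * eta / ((1 - q) * s)).
  by rewrite exprS; field; rewrite !gt_eqF.
apply: (@le_trans _ _ (2 * (eta / s) + q * l2norm (dev (col y (W tau r.*2))))); last first.
  by rewrite lerD2l ler_wpM2l.
set b := l2norm (dev (col y (W tau r.*2))).
have b0 : 0 <= b by exact: l2norm_ge0.
have qes : q * (eta / s) <= eta / s by rewrite ler_piMl// ltW.
rewrite doubleS; case: tau @b b0 {IH} => b b0.
- have h2 := step false r.*2 q (contrF _).
  have := step true r.*2.+1 1 (contrT _); rewrite /= in h2 *.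
  by move=> h; move: h2 h; rewrite -/b; lra.
- have h2 := step true r.*2 1 (contrT _).
  have := step false r.*2.+1 q (contrF _); rewrite /= in h2 *.
  move=> h; move: h2 h; rewrite -/b => h2 h.
  apply: (le_trans h); move: (ler_wpM2l q0 h2); lra.
Qed.

(** The entry of a product of 4r factors is the inner product of a row and a
    column of products of 2r factors.  Their constant parts contribute the product
    of their masses over n, and the deviations, of norm at most
    [2 * eps / sqrt n] each, contribute at most [4 * eps ^+ 2 / n]. *)
Lemma altmx_mixing (eps : R) (r : nat) tau x y :
    0 <= eps <= 1 -> q ^+ r <= eps / s -> 2 * eta / (1 - q) <= eps ->
    r.*2%:R * eta <= eps ->
  (1 - 6 * eps) / n%:R <= W tau r.*2.*2 x y <= (1 + 4 * eps) / n%:R.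
Proof.
move=> /andP[eps0 eps1] hq heta hr.
have [q0 q1] := andP q_bound.
have h1 : 0 < 1 - q by rewrite subr_gt0.
set f := col y (W tau r.*2); set g := col x (W (~~ tau) r.*2).
have dev_le tau' z : l2norm (dev (col z (W tau' r.*2))) <= 2 * eps / s.
  apply: le_trans (dev_col _ _ _) _.
  have -> : 2 * eta / ((1 - q) * s) = (2 * eta / (1 - q)) / s.
    by field; rewrite !gt_eqF.
  have : (2 * eta / (1 - q)) / s <= eps / s by rewrite ler_wpM2r// invr_ge0 ltW.
  lra.
have mean_bound tau' z : (1 - eps) / n%:R <= mean (col z (W tau' r.*2)) <= n%:R^-1.
  rewrite /mean; under eq_bigr do rewrite mxE altmx_sym//.
  rewrite -[X in _ <= _ <= X]mul1r !ler_pM2r ?invr_gt0// altmx_row_le1// andbT.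
  apply: le_trans (altmx_row_ge N_ge0 _ _ _ eta_ge0 N_row_ge) => //; lra.
have -> : W tau r.*2.*2 x y = n%:R * (mean g * mean f) + dot (dev g) (dev f).
  rewrite -addnn altmxD odd_double addbF mxE.
  transitivity (dot g f).
    apply: eq_bigr => z _; rewrite [in RHS]mxE [in RHS]mxE; congr (_ * _).
    by rewrite (altmx_sym N_sym) odd_double addbF negbK.
  have -> : dot g f = mean g * (\sum_i dev f i 0) + (\sum_i dev g i 0) * mean f
       + (dot (dev g) (dev f) + n%:R * (mean g * mean f)).
    rewrite /dot -sum_const mulr_sumr mulr_suml -!big_split/=.
    by apply: eq_bigr => i _; rewrite !mxE; ring.
  by rewrite !sum_dev mulr0 mul0r !add0r addrC.
have hdot : `|dot (dev g) (dev f)| <= 4 * eps / n%:R.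
  apply: le_trans (dot_le _ _) _.
  apply: (@le_trans _ _ ((2 * eps / s) * (2 * eps / s))).
    by apply: ler_pM (dev_le _ _) (dev_le _ _); exact: l2norm_ge0.
  have -> : 2 * eps / s * (2 * eps / s) = 4 * (eps * eps) / n%:R.
    by rewrite invn; ring.
  by rewrite ler_pM2r ?invr_gt0// ler_pM2l// ler_piMl.
have /andP[mg1 mg2] := mean_bound (~~ tau) x.
have /andP[mf1 mf2] := mean_bound tau y.
rewrite -/f in mf1 mf2; rewrite -/g in mg1 mg2.
have lo0 : 0 <= (1 - eps) / n%:R by rewrite divr_ge0 ?subr_ge0// ltW.
have prod_lo : (1 - 2 * eps) / n%:R <= n%:R * (mean g * mean f).
  apply: (@le_trans _ _ (n%:R * ((1 - eps) / n%:R * ((1 - eps) / n%:R)))); last first.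
    by apply: ler_wpM2l; [exact: ltW | exact: ler_pM].
  have -> : n%:R * ((1 - eps) / n%:R * ((1 - eps) / n%:R)) = (1 - eps) ^+ 2 / n%:R.
    by field; rewrite gt_eqF.
  by rewrite ler_pM2r ?invr_gt0//; nra.
have prod_hi : n%:R * (mean g * mean f) <= n%:R^-1.
  apply: (@le_trans _ _ (n%:R * (n%:R^-1 * n%:R^-1))).
    by apply: ler_wpM2l; [exact: ltW | apply: ler_pM => //; exact: (le_trans lo0)].
  by rewrite mulVKf// gt_eqF.
move: hdot; rewrite ler_norml => /andP[d1 d2].
move: prod_lo prod_hi d1 d2; set i := n%:R^-1; move=> *.
apply/andP; split; nra.
Qed.

End Mixing.

(** * Weighted walks and repeated edges *)

(** Sum of F over the walks with m alternating steps from x, weighted by the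
    product of their entries of N.  Walks are untyped sequences rather than tuples
    so that a walk of length p + q can be cut without casts. *)
Fixpoint wsum {R : pzRingType} {n : nat} (N : bool -> 'M[R]_n) (tau : bool) (m : nat)
    (x : 'I_n) (F : seq 'I_n -> R) : R :=
  if m is m'.+1 then
    \sum_y N tau x y * wsum N (~~ tau) m' y (fun s => F (y :: s))
  else F [::].

Definition walk_edges {T : finType} (x : T) (s : seq T) : seq {set T} :=
  pairmap (fun u v => [set u; v])%SET x s.

Section WeightedWalks.
Variables (R : realType) (n : nat) (N : bool -> 'M[R]_n).
Hypothesis N_ge0 : forall tau x y, 0 <= N tau x y.
Local Notation W := (altmx N).
Local Notation E := (wsum N).
Implicit Types (F G : seq 'I_n -> R).

Lemma wsum_le tau m x F G :
  (forall s, size s = m -> F s <= G s) -> E tau m x F <= E tau m x G.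
Proof.
elim: m tau x F G => [|m IH] tau x F G FG /=; first exact: FG.
apply: ler_sum => y _; rewrite ler_wpM2l//; apply: IH => s sm.
by apply: FG; rewrite /= sm.
Qed.

Lemma eq_wsum tau m x F G :
  (forall s, size s = m -> F s = G s) -> E tau m x F = E tau m x G.
Proof.
by move=> FG; apply/le_anti; rewrite !wsum_le// => s /FG ->.
Qed.

Lemma wsumD tau m x F G :
  E tau m x (fun s => F s + G s) = E tau m x F + E tau m x G.
Proof.
elim: m tau x F G => [|m IH] tau x F G //=.
by rewrite -big_split/=; apply: eq_bigr => y _; rewrite IH mulrDr.
Qed.

Lemma wsum_sum (I : Type) (r : seq I) (P : pred I) tau m x (F : I -> seq 'I_n -> R) :
  E tau m x (fun s => \sum_(i <- r | P i) F i s) = \sum_(i <- r | P i) E tau m x (F i).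
Proof.
elim: m tau x F => [|m IH] tau x F //=.
rewrite exchange_big/=; apply: eq_bigr => y _.
by rewrite -mulr_sumr; congr (_ * _); exact: (IH _ _ (fun i s => F i (y :: s))).
Qed.

Lemma wsum_cat tau p q x F :
  E tau (p + q) x F =
  E tau p x (fun s1 => E (tau (+) odd p) q (last x s1) (fun s2 => F (s1 ++ s2))).
Proof.
elim: p tau x F => [|p IH] tau x F /=; first by rewrite addbF.
apply: eq_bigr => y _; rewrite IH; congr (_ * E _ _ _ _).
by apply/funext => s; rewrite addNb addbN.
Qed.

Lemma wsum_last tau m x (g : 'I_n -> R) :
  E tau m x (fun s => g (last x s)) = \sum_z W tau m x z * g z.
Proof.
elim: m tau x => [|m IH] tau x /=.
  rewrite (bigD1 x)//= big1 ?addr0 ?mxE ?eqxx ?mul1r// => z /negPf zx.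
  by rewrite mxE eq_sym zx mul0r.
under eq_bigr do rewrite IH mulr_sumr.
rewrite exchange_big/=; apply: eq_bigr => z _.
by rewrite mxE mulr_suml; apply: eq_bigr => y _; rewrite mulrA.
Qed.

Lemma sum_pred1 (f : 'I_n -> R) j : \sum_z f z * (z == j)%:R = f j.
Proof.
rewrite (bigD1 j)//= eqxx mulr1 big1 ?addr0// => z /negPf ->.
by rewrite mulr0.
Qed.

Lemma wsum_endpoint tau m x j : E tau m x (fun s => (last x s == j)%:R) = W tau m x j.
Proof. by rewrite (wsum_last _ _ _ (fun z => (z == j)%:R)) sum_pred1. Qed.

Lemma wsum_edge tau p q x F :
  E tau (p + q.+1) x F =
  E tau p x (fun s1 => \sum_y N (tau (+) odd p) (last x s1) y *
     E (~~ (tau (+) odd p)) q y (fun s2 => F (s1 ++ y :: s2))).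
Proof. by rewrite wsum_cat. Qed.

Lemma size_walk_edges (x : 'I_n) s : size (walk_edges x s) = size s.
Proof. exact: size_pairmap. Qed.

Lemma nth_walk_edges_mid x (y : 'I_n) s1 s2 :
  nth finset.set0 (walk_edges x (s1 ++ y :: s2)) (size s1) = [set last x s1; y]%SET.
Proof.
by rewrite /walk_edges pairmap_cat/= nth_cat size_pairmap ltnn subnn.
Qed.

Lemma nth_walk_edges_right x (y : 'I_n) s1 s2 l :
  nth finset.set0 (walk_edges x (s1 ++ y :: s2)) (size s1 + l.+1) = nth finset.set0 (walk_edges y s2) l.
Proof.
rewrite /walk_edges pairmap_cat/= nth_cat size_pairmap.
by rewrite ltnNge leq_addr /= addKn.
Qed.

Lemma eq_set2_le (x y u v : 'I_n) :
  (([set u; v] == [set x; y])%SET)%:R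
    <= (u == x)%:R * (v == y)%:R + (u == y)%:R * (v == x)%:R :> R.
Proof.
have [e|_] := eqVneq; last by rewrite addr_ge0// mulr_ge0.
have : u \in [set x; y]%SET by rewrite -e !inE eqxx.
have : v \in [set x; y]%SET by rewrite -e !inE eqxx orbT.
have : x \in [set u; v]%SET by rewrite e !inE eqxx.
have : y \in [set u; v]%SET by rewrite e !inE eqxx orbT.
rewrite !inE (eq_sym y) (eq_sym x u) (eq_sym y v) (eq_sym x v).
do 4 case: eqVneq => //= _; rewrite ?mulr1 ?mulr0 ?addr0 ?add0r ?lexx//; lra.
Qed.


Lemma wsumZ tau m x (a : R) F : E tau m x (fun s => a * F s) = a * E tau m x F.
Proof.
elim: m tau x F => [|m IH] tau x F //=.
by rewrite mulr_sumr; apply: eq_bigr => y _; rewrite IH mulrCA.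
Qed.

Lemma wsum_at_edge tau p q k (g : 'I_n -> R) (h : {set 'I_n} -> R) :
  E tau (p + q.+1) k (fun s =>
     g (last k s) * h (nth finset.set0 (walk_edges k s) p))
  = \sum_x W tau p k x * \sum_y N (tau (+) odd p) x y *
     (h [set x; y]%SET * \sum_z W (~~ (tau (+) odd p)) q y z * g z).
Proof.
rewrite wsum_edge -(wsum_last _ _ _ (fun x => \sum_y _)).
apply: eq_wsum => s1 s1p; apply: eq_bigr => y _; congr (_ * _).
rewrite -wsum_last -wsumZ; apply: eq_wsum => s2 _.
by rewrite -s1p nth_walk_edges_mid last_cat mulrC.
Qed.

(** The edge can be traversed in its two directions. *)
Lemma wsum_through_edge tau p q k j (u v : 'I_n) :
  E tau (p + q.+1) k (fun s => (last k s == j)%:R *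
      ([set u; v]%SET == nth finset.set0 (walk_edges k s) p)%:R)
  <= W tau p k u * N (tau (+) odd p) u v * W (~~ (tau (+) odd p)) q v j
   + W tau p k v * N (tau (+) odd p) v u * W (~~ (tau (+) odd p)) q u j.
Proof.
rewrite (wsum_at_edge _ _ _ _ (fun z => (z == j)%:R)
  (fun e => ([set u; v]%SET == e)%:R)).
set X := tau (+) odd p.
apply: (@le_trans _ _ (\sum_x W tau p k x * \sum_y N X x y *
   (((u == x)%:R * (v == y)%:R + (u == y)%:R * (v == x)%:R) * W (~~ X) q y j))).
  apply: ler_sum => x _; rewrite ler_wpM2l ?altmx_ge0//.
  apply: ler_sum => y _; rewrite ler_wpM2l// sum_pred1.
  by rewrite ler_wpM2r ?altmx_ge0// eq_set2_le.
have row x : \sum_y N X x y *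
   (((u == x)%:R * (v == y)%:R + (u == y)%:R * (v == x)%:R) * W (~~ X) q y j)
   = (N X x v * W (~~ X) q v j) * (x == u)%:R
   + (N X x u * W (~~ X) q u j) * (x == v)%:R.
  rewrite -(sum_pred1 (fun y => N X x y * W (~~ X) q y j) v).
  rewrite -(sum_pred1 (fun y => N X x y * W (~~ X) q y j) u).
  rewrite !mulr_suml -big_split/=; apply: eq_bigr => y _.
  rewrite (eq_sym u x) (eq_sym v y) (eq_sym u y) (eq_sym v x); ring.
under eq_bigr do rewrite row mulrDr !mulrA.
by rewrite big_split/= !sum_pred1.
Qed.

(** The second visit to the edge {x, y} of the step at position p goes in the same
    or in the opposite direction.  Apply [wsum_through_edge] to the rest of the
    walk, which starts at y. *)
Lemma wsum_repeated_edge tau p l q k j X Y :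
  X = tau (+) odd p -> Y = ~~ X (+) odd l ->
  E tau (p + (l + q.+1).+1) k (fun s => (last k s == j)%:R *
      (nth finset.set0 (walk_edges k s) p
         == nth finset.set0 (walk_edges k s) (p + l.+1))%:R)
  <= \sum_x W tau p k x * \sum_y N X x y *
     (W (~~ X) l y x * N Y x y * W (~~ Y) q y j
    + W (~~ X) l y y * N Y y x * W (~~ Y) q x j).
Proof.
move=> -> ->; rewrite wsum_edge -(wsum_last _ _ _ (fun x => \sum_y _)).
apply: wsum_le => s1 s1p; apply: ler_sum => y _; rewrite ler_wpM2l//.
apply: le_trans (wsum_through_edge _ _ _ _ _ _ _).
apply: wsum_le => s2 _.
by rewrite -s1p nth_walk_edges_mid nth_walk_edges_right last_cat.
Qed.

End WeightedWalks.

(** [a true] and [a false] are disjoint graphs, the first one of smaller degree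
    bound.  In a walk weighted by [stepmx], every vertex that is forced rather than
    chosen gains the inverse of a degree bound. *)
Section RepeatedEdges.
Variables (R : realType) (n : nat) (a : bool -> rel 'I_n) (Dg : bool -> R).
Hypothesis Dg_gt0 : forall tau, 0 < Dg tau.
Hypothesis Dg_le : Dg true <= Dg false.
Hypothesis a_sym : forall tau, symmetric (a tau).
Hypothesis a_irr : forall tau x, a tau x x = false.
Hypothesis a_disj : forall tau x y, a tau x y -> a (~~ tau) x y = false.
Hypothesis a_deg : forall tau x, \sum_y (a tau x y)%:R <= Dg tau.

Definition stepmx (tau : bool) : 'M[R]_n := \matrix_(x, y) ((a tau x y)%:R / Dg tau).
Local Notation N := stepmx.
Local Notation W := (altmx stepmx).
Local Notation E := (wsum stepmx).

Lemma stepmx_ge0 tau x y : 0 <= N tau x y.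
Proof. by rewrite mxE divr_ge0// ltW. Qed.

Lemma stepmx_sym tau : (N tau)^T = N tau.
Proof. by apply/matrixP => x y; rewrite !mxE a_sym. Qed.

Lemma stepmx_row tau x : \sum_y N tau x y <= 1.
Proof.
under eq_bigr do rewrite mxE.
by rewrite -mulr_suml ler_pdivrMr// mul1r.
Qed.

Lemma stepmx_le tau x y : N tau x y <= (Dg tau)^-1.
Proof. by rewrite mxE ler_piMl ?invr_ge0 ?(ltW (Dg_gt0 _))// lern1 leq_b1. Qed.

Let W_ge0 := altmx_ge0 stepmx_ge0.
Let W_row := altmx_row_le1 stepmx_ge0 stepmx_row.
Let W_col := altmx_col_le1 stepmx_ge0 stepmx_sym stepmx_row.
Hint Resolve stepmx_ge0 W_ge0 W_row W_col : core.

Let iD_gt0 tau : 0 < (Dg tau)^-1. Proof. by rewrite invr_gt0. Qed.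
Let iD_ge0 tau : 0 <= (Dg tau)^-1. Proof. exact: ltW. Qed.
Let iD_le tau : (Dg false)^-1 <= (Dg tau)^-1.
Proof. by case: tau => //; rewrite lef_pV2 ?posrE. Qed.

Lemma altmx_first_step_le tau m x y : (0 < m)%N -> W tau m x y <= (Dg tau)^-1.
Proof.
case: m => // m _ /=; rewrite mxE.
apply: (@le_trans _ _ (\sum_z (Dg tau)^-1 * W (~~ tau) m z y)).
  by apply: ler_sum => z _; rewrite ler_wpM2r// stepmx_le.
by rewrite -mulr_sumr ler_piMr.
Qed.

Lemma altmx_last_step_le tau m x y : (0 < m)%N ->
  W tau m x y <= (Dg (~~ tau (+) odd m))^-1.
Proof. by move=> m0; rewrite (altmx_sym stepmx_sym) altmx_first_step_le. Qed.

(** Some step of type [false] is available to be forced: if the walk starts with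
    the other type, its second step has type [false], unless it consists of a
    single step, and then it would be an edge from x to y of type [true]. *)
Lemma altmx_closing_le tau m x y : odd m -> ~~ a (~~ tau) x y ->
  W (~~ tau) m x y <= (Dg false)^-1.
Proof.
case: tau => /= m_odd axy.
  by apply: altmx_first_step_le; case: m m_odd.
case: m m_odd => [|[_|m _]] //.
  by rewrite altmx1 mxE (negPf axy) mul0r.
rewrite -[W _ _]/(N true *m W false m.+1) mxE.
apply: (@le_trans _ _ (\sum_z N true x z * (Dg false)^-1)).
  by apply: ler_sum => z _; rewrite ler_wpM2l// altmx_first_step_le.
by rewrite -mulr_suml ler_piMl// stepmx_row.
Qed.

Variables (sigma : bool) (j k : 'I_n) (kappa : R) (m0 m : nat).
Hypothesis a_jk : a sigma j k.
Hypothesis W_long : forall tau l x y, (m0 <= l)%N -> W tau l x y <= kappa.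
Hypothesis m0_gt0 : (0 < m0)%N.
Hypothesis m_odd : odd m.
Hypothesis m_long : (3 * m0 <= m)%N.
Local Notation rho := ((Dg true)^-1 * (Dg false)^-1).

Let j_neq_k : j != k.
Proof. by apply/eqP => jk; move: a_jk; rewrite jk a_irr. Qed.

Let kappa_ge0 : 0 <= kappa.
Proof. exact: le_trans (W_ge0 true m0 j k) (W_long _ _ _ _). Qed.

Let rho_ge0 : 0 <= rho. Proof. by rewrite mulr_ge0. Qed.

Let iD_rho tau : (Dg tau)^-1 * (Dg false)^-1 <= rho.
Proof. by case: tau; rewrite // ler_wpM2r. Qed.

Let iD_rhoC tau : (Dg tau)^-1 * (Dg (~~ tau))^-1 = rho.
Proof. by case: tau => //=; rewrite mulrC. Qed.

Let closing X l u v : odd l -> a X u v || (u == v) -> W (~~ X) l u v <= (Dg false)^-1.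
Proof.
move=> lo h; apply: altmx_closing_le => //.
by case/orP: h => [/a_disj->|/eqP->]//; rewrite a_irr.
Qed.

(** A walk from k to j that uses the edge {j, k} again: the traversal of that edge
    is forced, one of the two segments is long, and the other one joins two,
    possibly equal, endpoints of the edge and falls under [altmx_closing_le]. *)
Lemma wsum_base_edge_le p : (p < m)%N ->
  E (~~ sigma) m k (fun s => (last k s == j)%:R *
      ([set j; k]%SET == nth finset.set0 (walk_edges k s) p)%:R)
  <= 2 * kappa * rho.
Proof.
move=> pm; pose q := (m - p.+1)%N.
have mE : m = (p + q.+1)%N by rewrite /q; lia.
rewrite [X in E _ X]mE; apply: le_trans (wsum_through_edge stepmx_ge0 _ _ _ _ _ _ _) _.
have [p_odd|p_even] := boolP (odd p); last first.
  have N0 x y : a sigma x y -> N (~~ sigma) x y = 0.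
    by move=> /a_disj axy; rewrite mxE axy mul0r.
  have a_kj : a sigma k j by rewrite a_sym.
  rewrite addbF (N0 _ _ a_jk) (N0 _ _ a_kj) !mulr0 !mul0r addr0.
  by rewrite !mulr_ge0.
have q_odd : odd q by move: m_odd; rewrite mE oddD /= p_odd; case: (odd q).
rewrite addbT negbK.
have key u v x y : a sigma u v || (u == v) -> a sigma x y || (x == y) -> forall w z,
   W (~~ sigma) p u v * N sigma w z * W (~~ sigma) q x y <= kappa * rho.
  move=> huv hxy w z.
  have pq : (m0 <= p)%N || (m0 <= q)%N by move: m_long m0_gt0; rewrite mE; lia.
  have prod : W (~~ sigma) p u v * W (~~ sigma) q x y <= kappa * (Dg false)^-1.
    case/orP: pq => [pl|ql].
      by apply: ler_pM => //; [exact: W_long | exact: closing].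
    by rewrite mulrC; apply: ler_pM => //; [exact: W_long | exact: closing].
  rewrite mulrAC; apply: (@le_trans _ _ (kappa * (Dg false)^-1 * (Dg sigma)^-1)).
    by apply: ler_pM => //; [exact: mulr_ge0 | exact: stepmx_le].
  by rewrite -mulrA ler_wpM2l// mulrC.
have := key k k j j; rewrite !eqxx !orbT => /(_ isT isT k j).
have := key k j k j; rewrite a_sym a_jk => /(_ isT isT j k).
lra.
Qed.

(** A walk from k to j that uses the same edge at positions p and p + l + 1.
    Repeated edges have the same type, so the middle segment has odd length, and it
    joins endpoints of the repeated edge.  If it is short, [altmx_closing_le]
    applies to it.  If it is long, the outer segments must save the factor.  When
    the edge is traversed twice in the same direction, the first segment, the edge
    and the last segment join up to a shorter alternating walk from k to j, which
    closes the edge {j, k}.  When it is traversed back, the outer segments meet at a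
    vertex x, and one of them has a forced step because j <> k. *)
Lemma wsum_edge_pair_le p l : (p + l.+1 < m)%N ->
  E (~~ sigma) m k (fun s => (last k s == j)%:R *
      (nth finset.set0 (walk_edges k s) p
         == nth finset.set0 (walk_edges k s) (p + l.+1))%:R)
  <= 2 * kappa * rho.
Proof.
move=> plm; pose q := (m - (p + l.+1).+1)%N.
have mE : m = (p + (l + q.+1).+1)%N by rewrite /q; lia.
rewrite [X in E _ X]mE.
apply: le_trans (wsum_repeated_edge stepmx_ge0 _ _ _ (erefl _) (erefl _)) _.
set X := ~~ sigma (+) odd p.
have [l_odd|l_even] := boolP (odd l); last first.
  rewrite big1 ?mulr_ge0// => x _; rewrite big1 ?mulr0// => y _.
  have [axy|/negPf axy] := boolP (a X x y); last by rewrite mxE axy !mul0r.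
  have N0 : N (~~ X) x y = 0 by rewrite mxE a_disj// mul0r.
  have N0' : N (~~ X) y x = 0 by rewrite mxE a_sym a_disj// mul0r.
  by rewrite addbF N0 N0' !mulr0 !mul0r addr0 mulr0.
rewrite addbT negbK.
have pq_even : odd p = odd q.
  by move: m_odd; rewrite mE !(oddD, oddS) l_odd; case: (odd p); case: (odd q).
have NN x y : N X x y * N X x y = (Dg X)^-1 * N X x y.
  by rewrite !mxE; case: (a X x y); rewrite ?(mul0r, mulr0, mul1r).
have NC x y : N X y x = N X x y by rewrite !mxE a_sym.
have -> : \sum_x W (~~ sigma) p k x * \sum_y N X x y *
     (W (~~ X) l y x * N X x y * W (~~ X) q y j
    + W (~~ X) l y y * N X y x * W (~~ X) q x j)
  = (Dg X)^-1 * \sum_x W (~~ sigma) p k x * \sum_y N X x y *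
     (W (~~ X) l y x * W (~~ X) q y j + W (~~ X) l y y * W (~~ X) q x j).
  rewrite mulr_sumr; apply: eq_bigr => x _; rewrite [in RHS]mulrCA; congr (_ * _).
  rewrite mulr_sumr; apply: eq_bigr => y _; rewrite NC [RHS]mulrA -NN; ring.
have closeL x y : N X x y * (W (~~ X) l y x * W (~~ X) q y j + W (~~ X) l y y * W (~~ X) q x j)
   <= N X x y * ((Dg false)^-1 * (W (~~ X) q y j + W (~~ X) q x j)).
  have [axy|/negPf axy] := boolP (a X x y); last by rewrite mxE axy !mul0r.
  rewrite ler_wpM2l// mulrDr lerD// ler_wpM2r// closing//.
  - by rewrite a_sym axy.
  - by rewrite eqxx orbT.
have short_le (b : R) : 0 <= b -> \sum_x W (~~ sigma) p k x * \sum_y N X x y *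
      (W (~~ X) q y j + W (~~ X) q x j) <= b ->
  (Dg X)^-1 * \sum_x W (~~ sigma) p k x * \sum_y N X x y *
     (W (~~ X) l y x * W (~~ X) q y j + W (~~ X) l y y * W (~~ X) q x j)
  <= b * rho.
  move=> b0 hb; apply: (@le_trans _ _ ((Dg X)^-1 * ((Dg false)^-1 * b))); last first.
    by rewrite mulrA mulrC ler_wpM2l.
  rewrite ler_wpM2l// (le_trans _ (ler_wpM2l (iD_ge0 false) hb))//.
  rewrite mulr_sumr; apply: ler_sum => x _; rewrite mulrCA ler_wpM2l//.
  rewrite mulr_sumr; apply: ler_sum => y _; rewrite mulrCA; exact: closeL.
have : [|| (m0 <= p)%N, (m0 <= q)%N | (m0 <= l)%N].
  by move: m_long m0_gt0; rewrite mE; lia.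
case/or3P => [long|long|long].
- apply: short_le; first exact: mulr_ge0.
  apply: (@le_trans _ _ (\sum_x kappa * \sum_y N X x y *
      (W (~~ X) q y j + W (~~ X) q x j))).
    apply: ler_sum => x _; rewrite ler_wpM2r ?W_long//.
    by apply: sumr_ge0 => y _; rewrite mulr_ge0// addr_ge0.
  rewrite -mulr_sumr [X in _ <= X]mulrC ler_wpM2l//.
  have -> : \sum_x \sum_y N X x y * (W (~~ X) q y j + W (~~ X) q x j)
    = \sum_y (\sum_x N X y x) * W (~~ X) q y j + \sum_x (\sum_y N X x y) * W (~~ X) q x j.
    under [X in _ = X + _]eq_bigr do rewrite mulr_suml.
    under [X in _ = _ + X]eq_bigr do rewrite mulr_suml.
    rewrite [X in _ = X + _]exchange_big/= -big_split/=; apply: eq_bigr => x _.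
    rewrite -big_split/=; apply: eq_bigr => y _.
    by rewrite mulrDr NC.
  have half : \sum_x (\sum_y N X x y) * W (~~ X) q x j <= 1.
    apply: le_trans (W_col (~~ X) q j); apply: ler_sum => x _.
    by rewrite ler_piMl// stepmx_row.
  have -> : 2 = 1 + 1 :> R by ring.
  exact: lerD.
- apply: short_le; first exact: mulr_ge0.
  apply: (@le_trans _ _ (\sum_x W (~~ sigma) p k x * (2 * kappa))); last first.
    by rewrite -mulr_suml ler_piMl// mulr_ge0.
  apply: ler_sum => x _; rewrite ler_wpM2l//.
  apply: (@le_trans _ _ (\sum_y N X x y * (2 * kappa))); last first.
    by rewrite -mulr_suml ler_piMl ?stepmx_row// mulr_ge0.
  apply: ler_sum => y _; rewrite ler_wpM2l//.
  have := W_long (~~ X) y j long; have := W_long (~~ X) x j long; lra.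
- have straight : \sum_x W (~~ sigma) p k x * \sum_y N X x y * W (~~ X) q y j
      <= (Dg false)^-1.
    have <- : W (~~ sigma) (p + q.+1) k j = \sum_x W (~~ sigma) p k x * \sum_y N X x y * W (~~ X) q y j.
      by rewrite altmxD mxE; apply: eq_bigr => x _; rewrite /= mxE.
    apply: closing; first by rewrite oddD oddS pq_even; case: (odd q).
    by rewrite a_sym a_jk.
  have turn : \sum_x W (~~ sigma) p k x * \sum_y N X x y * W (~~ X) q x j
      <= (Dg (~~ X))^-1.
    apply: (@le_trans _ _ (\sum_x W (~~ sigma) p k x * W (~~ X) q x j)).
      apply: ler_sum => x _; rewrite ler_wpM2l//.
      by rewrite -mulr_suml ler_piMl// stepmx_row.
    have [q0|q_gt0] := posnP q; last first.
      apply: (@le_trans _ _ (\sum_x W (~~ sigma) p k x * (Dg (~~ X))^-1)).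
        by apply: ler_sum => x _; rewrite ler_wpM2l// altmx_first_step_le.
      by rewrite -mulr_suml ler_piMl.
    rewrite q0 /=; under eq_bigr do rewrite mxE.
    rewrite sum_pred1; have [p0|p_gt0] := posnP p.
      by rewrite p0 /= mxE eq_sym (negPf j_neq_k).
    apply: le_trans (altmx_last_step_le _ _ _ p_gt0) _.
    by rewrite /X addNb addNb.
  have sum_le : \sum_x W (~~ sigma) p k x * \sum_y N X x y *
     (W (~~ X) l y x * W (~~ X) q y j + W (~~ X) l y y * W (~~ X) q x j)
    <= kappa * ((Dg false)^-1 + (Dg (~~ X))^-1).
    apply: (@le_trans _ _ (kappa * (\sum_x W (~~ sigma) p k x * \sum_y N X x y * W (~~ X) q y j
         + \sum_x W (~~ sigma) p k x * \sum_y N X x y * W (~~ X) q x j))); last first.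
      by rewrite ler_wpM2l// lerD.
    rewrite -big_split/= mulr_sumr; apply: ler_sum => x _.
    rewrite -mulrDr mulrCA ler_wpM2l// -big_split/= mulr_sumr; apply: ler_sum => y _.
    rewrite -mulrDr mulrCA ler_wpM2l// mulrDr lerD// ler_wpM2r//; exact: W_long.
  apply: (le_trans (ler_wpM2l (iD_ge0 X) sum_le)).
  have h1 := iD_rho X; have h2 := iD_rhoC X.
  rewrite mulrCA mulrDr h2 -[leRHS]mulrA mulrCA ler_wpM2l//; lra.
Qed.

Lemma not_uniq_cons_le (T : eqType) (x0 e : T) (l : seq T) :
  (~~ uniq (e :: l))%:R <= \sum_(p < size l) (e == nth x0 l p)%:R
    + \sum_(p < size l) \sum_(i < size l | (p + i.+1 < size l)%N)
        (nth x0 l p == nth x0 l (p + i.+1))%:R :> R.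
Proof.
have sum_ge0 (I : finType) (P b : pred I) : 0 <= \sum_(i | P i) (b i)%:R :> R.
  by apply: sumr_ge0.
have one_le (I : finType) (P b : pred I) i0 : P i0 -> b i0 ->
    1 <= \sum_(i | P i) (b i)%:R :> R.
  by move=> P0 b0; rewrite (bigD1 i0)//= b0 lerDl; apply: sumr_ge0.
have sum2_ge0 : 0 <= \sum_(p < size l) \sum_(i < size l | (p + i.+1 < size l)%N)
        (nth x0 l p == nth x0 l (p + i.+1))%:R :> R.
  by apply: sumr_ge0 => p _; exact: sum_ge0.
have [|rep] := boolP (uniq (e :: l)); first by rewrite addr_ge0.
move: rep; rewrite /= negb_and negbK => /orP[el|].
  have il : (index e l < size l)%N by rewrite index_mem.
  rewrite -[leLHS]addr0 lerD//.
  by apply: (one_le _ _ _ (Ordinal il)); rewrite //= nth_index.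
move=> /(uniqPn x0)[p [r [pr rl e_pr]]].
have pl : (p < size l)%N := ltn_trans pr rl.
have il : (r - p.+1 < size l)%N by lia.
rewrite -[leLHS]add0r lerD// (bigD1 (Ordinal pl))//= -[leLHS]addr0 lerD//.
  have rE : (p + (r - p.+1).+1)%N = r by lia.
  by apply: (one_le _ _ _ (Ordinal il)); rewrite /= rE ?e_pr.
by apply: sumr_ge0 => i _; exact: sum_ge0.
Qed.

(** Union bound over the at most m + m^2 ways to repeat an edge. *)
Lemma wsum_trail_ge :
  W (~~ sigma) m k j - (m%:R + m%:R ^+ 2) * (2 * kappa * rho)
  <= E (~~ sigma) m k (fun s => (last k s == j)%:R * (uniq (walk_edges j (k :: s)))%:R).
Proof.
rewrite lerBlDl -wsum_endpoint.
set b := 2 * kappa * rho.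
have b0 : 0 <= b by rewrite !mulr_ge0.
have bad : E (~~ sigma) m k (fun s => (last k s == j)%:R *
   (~~ uniq (walk_edges j (k :: s)))%:R) <= (m%:R + m%:R ^+ 2) * b.
  pose nthe s i := nth finset.set0 (walk_edges k s) i.
  apply: (@le_trans _ _ (E (~~ sigma) m k (fun s =>
      \sum_(p < m) (last k s == j)%:R * ([set j; k]%SET == nthe s p)%:R
      + \sum_(p < m) \sum_(i < m | (p + i.+1 < m)%N)
         (last k s == j)%:R * (nthe s p == nthe s (p + i.+1)%N)%:R))).
    apply: wsum_le => // s sm.
    rewrite -mulr_sumr; under [X in _ <= _ + X]eq_bigr do rewrite -mulr_sumr.
    rewrite -mulr_sumr -mulrDr ler_wpM2l//.
    have := not_uniq_cons_le finset.set0 [set j; k]%SET (walk_edges k s).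
    by rewrite size_walk_edges sm.
  rewrite wsumD !wsum_sum mulrDl expr2.
  have sumb (c : R) (l : nat) : \sum_(p < l) c = l%:R * c.
    by rewrite sumr_const card_ord mulr_natl.
  apply: lerD.
    rewrite -sumb; apply: ler_sum => p _; exact: wsum_base_edge_le.
  rewrite -mulrA -2!sumb; apply: ler_sum => p _; rewrite wsum_sum big_mkcond/=.
  apply: ler_sum => i _; case: ifP => // pim; exact: wsum_edge_pair_le.
rewrite -(lerD2r (E (~~ sigma) m k (fun s => (last k s == j)%:R *
   (uniq (walk_edges j (k :: s)))%:R))) in bad.
apply: le_trans bad; rewrite -wsumD.
apply: wsum_le => // s _; case: uniq => /=; lra.
Qed.

Lemma wsum_trail_le :
  E (~~ sigma) m k (fun s => (last k s == j)%:R * (uniq (walk_edges j (k :: s)))%:R)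
  <= W (~~ sigma) m k j.
Proof.
rewrite -wsum_endpoint; apply: wsum_le => // s _.
by rewrite ler_piMr// lern1 leq_b1.
Qed.

End RepeatedEdges.

Fixpoint altwalk {T : Type} (a : bool -> rel T) (tau : bool) (x : T) (s : seq T) : bool :=
  if s is y :: s' then a tau x y && altwalk a (~~ tau) y s' else true.

Lemma sum_tupleS (R : nmodType) (T : finType) (m : nat) (F : seq T -> R) :
  \sum_(s : m.+1.-tuple T) F s = \sum_(y : T) \sum_(s : m.-tuple T) F (y :: s).
Proof.
rewrite pair_big/= (reindex (fun p : T * m.-tuple T => [tuple of p.1 :: p.2]))//=.
exists (fun s : m.+1.-tuple T => (thead s, [tuple of behead s])) => [[y s] _|s _] /=.
  by rewrite theadE; congr (_, _); exact: val_inj.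
by rewrite [RHS]tuple_eta; exact: val_inj.
Qed.

(** The weights of [stepmx] turn a number of alternating walks into a weighted sum
    once the product of the degree bounds along the walk is taken out. *)
Lemma wsum_stepmx_count (R : realType) (n : nat) (a : bool -> rel 'I_n) (Dg : bool -> R)
    tau r x (F : seq 'I_n -> R) : (forall tau, 0 < Dg tau) ->
  \sum_(s : r.*2.+1.-tuple 'I_n) (altwalk a tau x s)%:R * F s
  = Dg tau * (Dg true * Dg false) ^+ r * wsum (stepmx a Dg) tau r.*2.+1 x F.
Proof.
move=> Dg_gt0.
have step m (c : R) tau' z (G : seq 'I_n -> R) :
    (forall y (G' : seq 'I_n -> R), \sum_(s : m.-tuple 'I_n) (altwalk a (~~ tau') y s)%:R * G' s
       = c * wsum (stepmx a Dg) (~~ tau') m y G') ->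
    \sum_(s : m.+1.-tuple 'I_n) (altwalk a tau' z s)%:R * G s
       = Dg tau' * c * wsum (stepmx a Dg) tau' m.+1 z G.
  move=> IH; rewrite (sum_tupleS _ (fun s => (altwalk a tau' z s)%:R * G s))/= mulr_sumr.
  apply: eq_bigr => y _.
  under eq_bigr do rewrite -mulnb natrM -mulrA.
  rewrite -mulr_sumr (IH y (fun s => G (y :: s))) mxE.
  by field; rewrite gt_eqF.
elim: r tau x F => [|r IH] tau x F.
  rewrite expr0; apply: step => y G.
  by rewrite (big_pred1 [tuple])/= ?mul1r// => s; apply/esym/eqP; exact: tuple0.
rewrite doubleS.
have -> : Dg tau * (Dg true * Dg false) ^+ r.+1
   = Dg tau * (Dg (~~ tau) * (Dg tau * (Dg true * Dg false) ^+ r)).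
  by rewrite exprS; case: tau => /=; ring.
apply: (step r.*2.+2) => y G; apply: (step r.*2.+1) => z G'.
by rewrite negbK; exact: IH.
Qed.

(** * Switching a factor along a closed trail *)

Section Graphs.
Variable n : nat.
Implicit Types (G S H : sgraph n) (x y j k : 'I_n).

Lemma adj_sym G x y : adj G x y = adj G y x.
Proof. by rewrite /adj finset.setUC. Qed.

Lemma adj_irr G x : adj G x x = false.
Proof.
apply/negP => e; have /forallP/(_ [set x; x]%SET) := edgesP G.
by move: e; rewrite /adj => -> /=; rewrite finset.setUid cards1.
Qed.

Lemma adj_neq G x y : adj G x y -> x != y.
Proof. by apply: contraTneq => ->; rewrite adj_irr. Qed.

Lemma degE G x : deg G x = (\sum_y adj G x y)%N.
Proof.
rewrite /deg -sum1_card big_mkcond; apply: eq_bigr => y _.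
by rewrite unfold_in /adj; case: (_ \in _).
Qed.

Definition sadj S H (tau : bool) x y : bool := adj S x y && (adj H x y == tau).

Lemma sadj_sym S H tau : symmetric (sadj S H tau).
Proof. by move=> x y; rewrite /sadj adj_sym (adj_sym H). Qed.

Lemma sadj_irr S H tau x : sadj S H tau x x = false.
Proof. by rewrite /sadj adj_irr. Qed.

Lemma sadj_disj S H tau x y : sadj S H tau x y -> sadj S H (~~ tau) x y = false.
Proof. by rewrite /sadj => /andP[-> /eqP->]; case: tau. Qed.

Fact switch_subproof S H (E : {set {set 'I_n}}) :
  is_edge_set (edges S :&: [set e | (e \in edges H) (+) (e \in E)])%SET.
Proof.
apply/forall_inP => e; rewrite inE => /andP[eS _].
by have /forall_inP/(_ e eS) := edgesP S.
Qed.

(** The symmetric difference of H and E.  The intersection with S makes the result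
    a graph for every E. *)
Definition switch S H (E : {set {set 'I_n}}) : sgraph n :=
  SGraph (switch_subproof S H E).

Lemma adj_switch S H (E : {set {set 'I_n}}) x y :
  adj (switch S H E) x y = adj S x y && (adj H x y (+) ([set x; y]%SET \in E)).
Proof. by rewrite /adj !inE. Qed.

Lemma switchK S H (E : {set {set 'I_n}}) : edges H \subset edges S ->
  E \subset edges S -> switch S (switch S H E) E = H.
Proof.
move=> /fintype.subsetP HS /fintype.subsetP ES; apply: val_inj; apply/setP => e /=.
rewrite !inE; have [eS|eS] /= := boolP (e \in edges S).
  by rewrite -addbA addbb addbF.
by symmetry; apply: contraNF eS; exact: HS.
Qed.

Lemma walk_edges_sub S H tau x s :
  altwalk (sadj S H) tau x s -> {subset walk_edges x s <= edges S}.
Proof.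
elim: s tau x => //= y s IH tau x /andP[/andP[xy _] /IH h] e.
by rewrite inE => /orP[/eqP->|/h].
Qed.

Lemma altwalk_switch S H (E : {set {set 'I_n}}) tau x s :
    {subset walk_edges x s <= E} ->
  altwalk (sadj S H) tau x s -> altwalk (sadj S (switch S H E)) (~~ tau) x s.
Proof.
elim: s tau x => //= y s IH tau x sub /andP[/andP[xyS /eqP xyH] alt].
have xyE : [set x; y]%SET \in E by apply: sub; rewrite inE eqxx.
rewrite IH ?andbT//; last by move=> e es; apply: sub; rewrite inE es orbT.
by rewrite /sadj adj_switch xyS xyE xyH; case: tau {xyH alt}.
Qed.

Definition switch_sign (b : bool) : int := if b then -1 else 1.

Lemma sum_nat_pred1 x : (\sum_y (y == x))%N = 1%N.
Proof. by rewrite (bigD1 x)//= eqxx big1 ?addn0// => y /negPf->. Qed.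

Lemma sum_eq_edge x y u : x != y ->
  \sum_v ((([set x; y] == [set u; v])%SET)%:R : int) = (u == x)%:R + (u == y)%:R.
Proof.
move=> xy.
have e v : (([set x; y] == [set u; v])%SET) = ((u == x) && (v == y)) || ((u == y) && (v == x)).
  apply/eqP/orP => [E|[/andP[/eqP-> /eqP->]//|/andP[/eqP-> /eqP->]]]; last exact: finset.setUC.
  have u_xy : u \in [set x; y]%SET by rewrite E !inE eqxx.
  have x_uv : x \in [set u; v]%SET by rewrite -E !inE eqxx.
  have y_uv : y \in [set u; v]%SET by rewrite -E !inE eqxx orbT.
  move: u_xy; rewrite !inE => /orP[/eqP ux|/eqP uy].
    by left; move: y_uv; rewrite !inE ux eqxx (eq_sym y x) (negPf xy) eq_sym.
  by right; move: x_uv; rewrite !inE uy eqxx (negPf xy) eq_sym.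
under eq_bigr do rewrite e.
have [->|ux] /= := eqVneq u x.
  rewrite (negPf xy) addr0; under eq_bigr do rewrite orbF.
  by rewrite -natr_sum sum_nat_pred1.
have [uy|uy] /= := eqVneq u y; last by rewrite big1.
by rewrite -natr_sum sum_nat_pred1.
Qed.

(** Switching adds an edge of type [false] and deletes one of type [true].  At each
    inner vertex of an alternating walk the two incident steps have opposite signs,
    so that only the contributions of the two ends remain. *)
Lemma altwalk_telescope S H tau x s u :
    altwalk (sadj S H) tau x s ->
  \sum_v \sum_(e <- walk_edges x s) ((e == [set u; v]%SET)%:R * switch_sign (adj H u v))
  = switch_sign tau * ((u == x)%:R - (-1) ^+ size s * (u == last x s)%:R).
Proof.
elim: s tau x => [|y s IH] tau x /=.
  move=> _; rewrite expr0 mul1r subrr mulr0 big1// => v _; exact: big_nil.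
move=> /andP[/andP[xyS /eqP xyH] /IH{}IH].
under eq_bigr do rewrite big_cons.
rewrite big_split/= IH.
have -> : \sum_v (([set x; y] == [set u; v])%SET%:R * switch_sign (adj H u v))
   = \sum_v (([set x; y] == [set u; v])%SET%:R * switch_sign tau).
  apply: eq_bigr => v _; have [e|_] := eqVneq; last by rewrite !mul0r.
  by rewrite -xyH /adj e.
rewrite -mulr_suml sum_eq_edge ?(adj_neq xyS)// exprS.
by case: tau {xyH IH} => /=; ring.
Qed.

Lemma deg_switch S H (E : {set {set 'I_n}}) tau x s u :
    edges H \subset edges S -> altwalk (sadj S H) tau x s ->
    uniq (walk_edges x s) -> E =i walk_edges x s -> last x s = x ->
    ~~ odd (size s) ->
  deg (switch S H E) u = deg H u.
Proof.
move=> /fintype.subsetP HS alt us Es closed even.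
have := altwalk_telescope u alt.
rewrite closed -signr_odd (negPf even) expr0 mul1r subrr mulr0.
have -> : \sum_v \sum_(e <- walk_edges x s)
    ((e == [set u; v]%SET)%:R * switch_sign (adj H u v))
  = \sum_v ((adj (switch S H E) u v)%:R - (adj H u v)%:R) :> int.
  apply: eq_bigr => v _; rewrite -mulr_suml -natr_sum.
  have -> : (\sum_(e <- walk_edges x s) (e == [set u; v]%SET))%N
     = ([set u; v]%SET \in walk_edges x s).
    by rewrite -big_mkcond/= sum1_count (count_uniq_mem _ us).
  rewrite adj_switch Es; have [uvE|uvE] := boolP (_ \in walk_edges _ _).
    by rewrite [adj S u v](walk_edges_sub alt uvE) addbT /=; case: adj.
  rewrite addbF mul0r.
  have [uvH|] := boolP (adj H u v); last by rewrite andbF.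
  by rewrite [adj S u v](HS _ uvH).
rewrite sumrB -!natr_sum -!degE => /eqP; rewrite subr_eq0 => /eqP.
by move=> /eqP; rewrite eqr_nat => /eqP.
Qed.

(** The closed walk is j, k, s with [last k s = j]; its first step, of type
    [sigma], is the edge jk. *)
Definition switchable S H (sigma : bool) j k (s : seq 'I_n) : bool :=
  [&& altwalk (sadj S H) sigma j (k :: s), last k s == j
    & uniq (walk_edges j (k :: s))].

Definition walk_set j k (s : seq 'I_n) : {set {set 'I_n}} :=
  [set e in walk_edges j (k :: s)]%SET.

Lemma switchable_switch S (t : 'I_n -> nat) H sigma j k s :
    H \in factors S t -> odd (size s) -> switchable S H sigma j k s ->
  [/\ switch S H (walk_set j k s) \in factors S t,
      switchable S (switch S H (walk_set j k s)) (~~ sigma) j k s &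
      switch S (switch S H (walk_set j k s)) (walk_set j k s) = H].
Proof.
rewrite inE => /andP[HS /forallP/= Ht] s_odd /and3P[alt /eqP closed us].
have ES : walk_set j k s \subset edges S.
  by apply/fintype.subsetP => e; rewrite inE; exact: (walk_edges_sub alt).
split; last exact: switchK.
- rewrite inE; apply/andP; split; first exact: subsetIl.
  apply/forallP => u; rewrite (deg_switch _ HS alt us _ closed) ?Ht//=.
    by move=> e; rewrite inE.
  by rewrite s_odd.
- apply/and3P; split => //; last by apply/eqP.
  by apply: altwalk_switch alt => e es; rewrite inE.
Qed.

(** For a fixed trail, switching is injective since it is an involution. *)
Lemma card_switch S (t : 'I_n -> nat) sigma j k s : odd (size s) ->
  (#|[set H in factors S t | switchable S H sigma j k s]|
     <= #|[set H in factors S t | switchable S H (~~ sigma) j k s]|)%N%SET.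
Proof.
move=> s_odd; pose f H := switch S H (walk_set j k s).
rewrite -(@card_in_imset _ _ f); last first.
  move=> H1 H2; rewrite inE => /andP[h1 s1]; rewrite inE => /andP[h2 s2] e12.
  have [_ _ <-] := switchable_switch h1 s_odd s1.
  have [_ _ <-] := switchable_switch h2 s_odd s2.
  by rewrite -!/(f _) e12.
apply/subset_leq_card/fintype.subsetP => H' /imsetP[H]; rewrite inE => /andP[h s1] ->.
by have [h' s' _] := switchable_switch h s_odd s1; rewrite inE; apply/andP.
Qed.

Lemma double_count_switch S (t : 'I_n -> nat) m j k : odd m ->
  (\sum_(H in factors S t) \sum_(s : m.-tuple 'I_n) switchable S H true j k s
   = \sum_(H in factors S t) \sum_(s : m.-tuple 'I_n) switchable S H false j k s)%N.
Proof.
move=> m_odd; rewrite exchange_big [RHS]exchange_big/=; apply: eq_bigr => s _.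
rewrite -!big_mkcondr/= !sum1dep_card.
have so : odd (size s) by rewrite size_tuple.
apply/eqP; rewrite eqn_leq; apply/andP; split.
  exact: (card_switch S t true j k so).
exact: (card_switch S t false j k so).
Qed.

End Graphs.

(** * The edge probability for one graph *)

(** The ratio N1 : N0 is d' : D' up to a factor (1 + theta) / (1 - theta); passing
    from N1 / N0 to N1 / (N1 + N0) costs a relative error of order d' / D'. *)
Lemma edge_ratio (R : realFieldType) (N1 N0 theta d' D' : R) :
    0 <= N1 -> 0 <= N0 -> 0 < N1 + N0 -> 0 < d' -> 0 < D' -> 0 <= theta <= 2^-1 ->
    (1 - theta) * N1 * D' <= (1 + theta) * N0 * d' ->
    (1 - theta) * N0 * d' <= (1 + theta) * N1 * D' ->
  `| N1 / (N1 + N0) - d' / D' | <= (4 * theta + 3 * (d' / D')) * (d' / D').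
Proof.
move=> N1_ge0 N0_ge0 T0 d'0 D'0 /andP[th0 th1] up low.
set p := N1 / (N1 + N0); set y := d' / D'.
have y0 : 0 < y by rewrite divr_gt0.
have p0 : 0 <= p by rewrite divr_ge0// ltW.
have p1 : p <= 1 by rewrite ler_pdivrMr// mul1r lerDl.
have up' : (1 - theta) * p <= (1 + theta) * (1 - p) * y.
  have -> : (1 - theta) * p = (1 - theta) * N1 * D' / ((N1 + N0) * D').
    by rewrite /p; field; rewrite !gt_eqF.
  have -> : (1 + theta) * (1 - p) * y = (1 + theta) * N0 * d' / ((N1 + N0) * D').
    by rewrite /p /y; field; rewrite !gt_eqF.
  by rewrite ler_pM2r// invr_gt0 mulr_gt0.
have low' : (1 - theta) * (1 - p) * y <= (1 + theta) * p.
  have -> : (1 + theta) * p = (1 + theta) * N1 * D' / ((N1 + N0) * D').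
    by rewrite /p; field; rewrite !gt_eqF.
  have -> : (1 - theta) * (1 - p) * y = (1 - theta) * N0 * d' / ((N1 + N0) * D').
    by rewrite /p /y; field; rewrite !gt_eqF.
  by rewrite ler_pM2r// invr_gt0 mulr_gt0.
clearbody p y.
have pu : p <= (1 + 4 * theta) * y.
  have h : (1 - theta) * p <= (1 - theta) * ((1 + 4 * theta) * y).
    apply: (le_trans up').
    have : 0 <= theta * y * (1 - 2 * theta) by rewrite !mulr_ge0 ?(ltW y0)//; lra.
    have : 0 <= (1 + theta) * p * y by rewrite !mulr_ge0 ?(ltW y0)//; lra.
    lra.
  by move: h; rewrite ler_pM2l//; lra.
rewrite ler_norml; apply/andP; split; last first.
  have : 0 <= y * y by rewrite mulr_ge0// ltW.
  nra.
have h1 : (theta + (1 - theta) * y) * p <= (3 * theta + 3 * y) * y.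
  have th3 : 0 <= theta + (1 - theta) * y by rewrite addr_ge0// mulr_ge0 ?ltW//; lra.
  apply: (le_trans (ler_wpM2l th3 pu)); rewrite mulrA ler_wpM2r ?ltW//.
  have : 0 <= theta * y by rewrite mulr_ge0// ltW.
  have : 0 <= theta * (2^-1 - theta) by rewrite mulr_ge0 ?subr_ge0.
  have : 0 <= theta * theta * y by rewrite !mulr_ge0// ltW.
  nra.
nra.
Qed.

Section FactorEstimate.
Variables (R : realType) (n : nat) (S : sgraph n) (t : 'I_n -> nat) (D d : nat).
Variables (c q eta eps : R) (r : nat).
Hypothesis d_gt0 : (0 < d)%N.
Hypothesis d_le_D : (d <= D)%N.
Hypothesis degS_le : forall x, (deg S x <= D)%N.
Hypothesis degS_ge : forall x, (1 - eta) * D%:R <= (deg S x)%:R - (t x)%:R.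
Hypothesis t_le : forall x, (t x <= d)%N.
Hypothesis t_ge : forall x, (1 - eta) * d%:R <= (t x)%:R.
Hypothesis S_contract : forall z : 'cV[R]_n, \sum_i z i 0 = 0 ->
  l2norm (adjmx R S *m z) <= c * D%:R * l2norm z.
Hypothesis c_ge0 : 0 <= c.
Hypothesis c_q : c + d%:R / D%:R <= q.
Hypothesis q_lt1 : q < 1.
Hypothesis eta_ge0 : 0 <= eta.
Hypothesis eps_bound : 0 <= eps <= 24^-1.
Hypothesis r_gt0 : (0 < r)%N.
Hypothesis r_mix : q ^+ r <= eps / Num.sqrt n%:R.
Hypothesis eta_q : 2 * eta / (1 - q) <= eps.
Hypothesis r_eta : (12 * r + 2)%:R * eta <= eps.
Hypothesis r_dD : (12 * r + 2)%:R ^+ 2 <= eps * (d%:R * D%:R).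

Definition degree_bound (tau : bool) : R := if tau then d%:R else D%:R.
Local Notation Dg := degree_bound.

(** Main term of the number of walks with 12 r + 1 steps, the first one of type
    [tau], between two given vertices. *)
Definition trail_scale (tau : bool) : R := Dg tau * (d%:R * D%:R) ^+ (6 * r) / n%:R.

Let d0 : 0 < d%:R :> R. Proof. by rewrite ltr0n. Qed.
Let D0 : 0 < D%:R :> R. Proof. by rewrite ltr0n (leq_trans d_gt0). Qed.

Let Dg_gt0 tau : 0 < Dg tau. Proof. by case: tau. Qed.
Let Dg_le : Dg true <= Dg false. Proof. by rewrite ler_nat. Qed.

Section FixedFactor.
Variable H : sgraph n.
Hypothesis H_factor : H \in factors S t.
Local Notation a := (sadj S H).
Local Notation N := (stepmx a Dg).
Local Notation W := (altmx N).

Let HS x y : adj H x y -> adj S x y.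
Proof. by move: H_factor; rewrite inE => /andP[/fintype.subsetP h _]; exact: h. Qed.

Let degH x : deg H x = t x.
Proof. by move: H_factor; rewrite inE => /andP[_ /forallP/(_ x)/eqP]. Qed.

Let sadj_true x y : a true x y = adj H x y.
Proof. by rewrite /sadj; have [/HS->|] := boolP (adj H x y); rewrite ?andbF. Qed.

Let sadj_falseE x y : (a false x y)%:R = (adj S x y)%:R - (adj H x y)%:R :> R.
Proof.
rewrite /sadj; have [/HS->|] := boolP (adj H x y); first by rewrite subrr.
by rewrite andbT subr0.
Qed.

Let sum_sadj tau x :
  \sum_y (a tau x y)%:R = (if tau then (t x)%:R else (deg S x)%:R - (t x)%:R) :> R.
Proof.
case: tau; first by under eq_bigr do rewrite sadj_true; rewrite -natr_sum -degE degH.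
under eq_bigr do rewrite sadj_falseE.
by rewrite sumrB -!natr_sum -!degE degH.
Qed.

Let sadj_deg tau x : \sum_y (a tau x y)%:R <= Dg tau.
Proof.
rewrite sum_sadj; case: tau => /=; first by rewrite ler_nat.
by rewrite lerBlDr; apply: (@le_trans _ _ D%:R); rewrite ?ler_nat// lerDl.
Qed.

Let N_row_ge tau x : 1 - eta <= \sum_y N tau x y.
Proof.
under eq_bigr do rewrite mxE.
by rewrite -mulr_suml ler_pdivlMr// sum_sadj; case: tau => /=.
Qed.

Let N_contract (z : 'cV[R]_n) : \sum_i z i 0 = 0 ->
  l2norm (N false *m z) <= q * l2norm z.
Proof.
move=> z0.
have -> : N false = D%:R^-1 *: (adjmx R S - adjmx R H).
  by apply/matrixP => x y; rewrite !mxE sadj_falseE mulrC.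
rewrite -scalemxAl l2normZ ger0_norm ?invr_ge0 ?(ltW D0)//.
rewrite mulrC ler_pdivrMr// mulmxBl.
apply: le_trans (l2normD _ _) _.
have -> : l2norm (- (adjmx R H *m z)) = l2norm (adjmx R H *m z).
  by rewrite -scaleN1r l2normZ normrN1 mul1r.
have hH : l2norm (adjmx R H *m z) <= d%:R * l2norm z.
  have rowH x : \sum_y adjmx R H x y <= d%:R.
    under eq_bigr do rewrite mxE.
    by rewrite -natr_sum -degE degH ler_nat.
  apply: l2norm_schur => //; first by move=> x y; rewrite mxE.
  move=> y; apply: le_trans (rowH y).
  by apply: ler_sum => x _; rewrite !mxE adj_sym.
have := S_contract z0.
have : (c + d%:R / D%:R) * l2norm z * D%:R <= q * l2norm z * D%:R.
  by rewrite ler_wpM2r ?(ltW D0)// ler_wpM2r// l2norm_ge0.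
have -> : (c + d%:R / D%:R) * l2norm z * D%:R = c * D%:R * l2norm z + d%:R * l2norm z.
  by field; rewrite gt_eqF.
by move=> h1 h2; apply: le_trans h1; exact: lerD.
Qed.

Let m0 := r.*2.*2.
Let m := (6 * r).*2.+1.

(** The length 4r suffices for mixing.  The length m = 3 * 4r + 1 is odd, and two
    marked steps cut it into three segments one of which has length at least 4r. *)
Lemma count_switchable (sigma : bool) (j k : 'I_n) : adj S j k -> adj H j k = sigma ->
  (1 - 11 * eps) * trail_scale (~~ sigma)
    <= \sum_(s : m.-tuple 'I_n) (switchable S H sigma j k s)%:R
    <= (1 + 11 * eps) * trail_scale (~~ sigma).
Proof.
move=> a_jk h_jk.
have n_gt0 : (0 < n)%N by apply: leq_ltn_trans (ltn_ord j).
have n0 : 0 < n%:R :> R by rewrite ltr0n.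
have [eps0 eps1] := andP eps_bound.
(* jk has type sigma, so the walk that completes it starts with the other type *)
have sjk : a sigma j k by rewrite /sadj a_jk h_jk eqxx.
have N0 := stepmx_ge0 a Dg_gt0.
have N1 := stepmx_row Dg_gt0 sadj_deg.
have Ns := stepmx_sym Dg (sadj_sym S H).
have q01 : 0 <= q < 1.
  by rewrite q_lt1 andbT (le_trans _ c_q)// addr_ge0// divr_ge0.
have mix tau x y : (1 - 6 * eps) / n%:R <= W tau m0 x y <= (1 + 4 * eps) / n%:R.
  apply: (altmx_mixing (q := q) (eta := eta)) => //.
  - by rewrite eps0 (le_trans eps1)//; lra.
  - apply: le_trans _ r_eta; apply: ler_wpM2r; [exact: eta_ge0 | rewrite ler_nat; clear; lia].
pose kappa := (1 + 4 * eps) / n%:R.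
have long tau l x y : (m0 <= l)%N -> W tau l x y <= kappa.
  apply: (altmx_uniform_le N0 N1) => tau' x' y'; by have /andP[] := mix tau' x' y'.
have m_long : (3 * m0 <= m)%N by rewrite /m0 /m; clear; lia.
have m_odd : odd m by rewrite /m /= odd_double.
have m0_gt0 : (0 < m0)%N by rewrite /m0; clear -r_gt0; lia.
have ge := wsum_trail_ge Dg_gt0 Dg_le (sadj_sym S H) (sadj_irr S H)
  (@sadj_disj _ S H) sadj_deg sjk long m0_gt0 m_odd m_long.
have le := wsum_trail_le a Dg_gt0 sigma j k m.
have lo : (1 - 7 * eps) / n%:R <= W (~~ sigma) m k j.
  have lo0 : 0 <= (1 - 6 * eps) / n%:R by rewrite divr_ge0 ?ltW//; lra.
  have h : (m0 <= m)%N by move: m_long; clear; lia.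
  have := altmx_uniform_ge (~~ sigma) k j N0 eta_ge0 N_row_ge lo0
     (fun tau x y => (andP (mix tau x y)).1) h.
  apply: le_trans.
  rewrite mulrAC ler_pM2r ?invr_gt0//.
  have : m%:R * eta <= eps.
    by apply: le_trans _ r_eta; apply: ler_wpM2r; [exact: eta_ge0 | rewrite ler_nat /m; clear; lia].
  move: (m%:R * eta) => u; nra.
have hi := long (~~ sigma) m k j (leq_trans (leq_pmull m0 (isT : 0 < 3)%N) m_long).
have bad : (m%:R + m%:R ^+ 2) * (2 * kappa * ((Dg true)^-1 * (Dg false)^-1))
    <= 4 * eps / n%:R.
  have -> : (m%:R + m%:R ^+ 2) * (2 * kappa * ((Dg true)^-1 * (Dg false)^-1))
     = ((m%:R + m%:R ^+ 2) / (d%:R * D%:R)) * (2 * kappa) :> R.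
    by rewrite /= invfM; ring.
  have dD0 : 0 < d%:R * D%:R :> R by rewrite mulr_gt0.
  have h1 : (m%:R + m%:R ^+ 2) / (d%:R * D%:R) <= eps :> R.
    rewrite ler_pdivrMr// (le_trans _ r_dD)//.
    have -> : (12 * r + 2)%:R = m%:R + 1 :> R by rewrite natr1; congr (_%:R); rewrite /m; clear; lia.
    have : 0 <= m%:R :> R by []. nra.
  have k2 : 2 * kappa <= 4 / n%:R.
    rewrite /kappa mulrA ler_pM2r ?invr_gt0//; lra.
  have -> : 4 * eps / n%:R = eps * (4 / n%:R) by ring.
  apply: ler_pM => //.
  by rewrite mulr_ge0// /kappa divr_ge0 ?(ltW n0)//; lra.
have -> : \sum_(s : m.-tuple 'I_n) (switchable S H sigma j k s)%:R
  = \sum_(s : m.-tuple 'I_n) (altwalk a (~~ sigma) k s)%:R *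
      ((last k s == j)%:R * (uniq (walk_edges j (k :: s)))%:R) :> R.
  by apply: eq_bigr => s _; rewrite /switchable [altwalk _ _ _ _]/= sjk -!mulnb !natrM.
rewrite (wsum_stepmx_count a (~~ sigma) (6 * r) k
  (fun s => (last k s == j)%:R * (uniq (walk_edges j (k :: s)))%:R) Dg_gt0).
rewrite [Dg true]/= [Dg false]/=.
set w := wsum _ _ _ _ _ in ge le *.
have sc0 : 0 <= Dg (~~ sigma) * (d%:R * D%:R) ^+ (6 * r).
  by rewrite mulr_ge0 ?ltW// exprn_gt0// mulr_gt0.
rewrite /trail_scale; set P := Dg _ * _ in sc0 *; rewrite !(mulrCA _ P).
apply/andP; split; rewrite ler_wpM2l//.
  apply: le_trans _ ge; apply: le_trans _ (lerB lo bad).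
  by rewrite -mulrBl ler_pM2r ?invr_gt0//; lra.
apply: (le_trans le); apply: (le_trans hi).
by rewrite ler_pM2r ?invr_gt0//; lra.
Qed.

End FixedFactor.

(** Double counting of pairs of a factor and a trail through jk: the same number of
    pairs is about N1 times D, and about N0 times d, times a common factor. *)
Lemma factor_edge_probability (j k : 'I_n) : adj S j k ->
    (exists H, H \in factors S t) ->
  `| unif_pr R (factors S t) (fun H => adj H j k) - d%:R / D%:R |
    <= (44 * eps + 3 * (d%:R / D%:R)) * (d%:R / D%:R).
Proof.
move=> a_jk [H0 H0_factor].
have [eps0 eps1] := andP eps_bound.
pose F sigma := [set H in factors S t | adj H j k == sigma]%SET.
pose N_ sigma : R := #|F sigma|%:R.
have n0 : 0 < n%:R :> R by rewrite ltr0n; apply: leq_ltn_trans (ltn_ord j).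
have total : #|factors S t|%:R = N_ true + N_ false.
  rewrite /N_ -natrD; congr _%:R.
  rewrite -(cardsID [set H | adj H j k]%SET); congr (_ + _)%N; apply: eq_card => H;
  by rewrite !inE ?eqb_id ?eqbF_neg // andbC.
have -> : unif_pr R (factors S t) (fun H => adj H j k) = N_ true / (N_ true + N_ false).
  rewrite /unif_pr -total /N_; congr (_%:R / _); apply: eq_card => H.
  by rewrite !inE eqb_id.
have count sigma :
    (1 - 11 * eps) * trail_scale (~~ sigma) * N_ sigma
    <= \sum_(H in factors S t) \sum_(s : (6 * r).*2.+1.-tuple 'I_n)
         (switchable S H sigma j k s)%:R
    <= (1 + 11 * eps) * trail_scale (~~ sigma) * N_ sigma.
  have -> : \sum_(H in factors S t) \sum_(s : (6 * r).*2.+1.-tuple 'I_n)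
         (switchable S H sigma j k s)%:R
    = \sum_(H in F sigma) \sum_(s : (6 * r).*2.+1.-tuple 'I_n)
         (switchable S H sigma j k s)%:R :> R.
    rewrite [LHS](bigID (fun H => adj H j k == sigma))/= [X in _ + X]big1 ?addr0.
      by apply: eq_bigl => H; rewrite [in RHS]inE.
    move=> H /andP[_ /negPf h]; apply: big1 => s _.
    by rewrite /switchable /= /sadj h andbF.
  have const b : b * N_ sigma = \sum_(H in F sigma) b.
    by rewrite sumr_const mulr_natr.
  rewrite !const; apply/andP; split; apply: ler_sum => H; rewrite inE => /andP[hH /eqP hs].
    by have /andP[] := count_switchable hH a_jk hs.
  by have /andP[] := count_switchable hH a_jk hs.
have same : \sum_(H in factors S t) \sum_(s : (6 * r).*2.+1.-tuple 'I_n)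
         (switchable S H true j k s)%:R
  = \sum_(H in factors S t) \sum_(s : (6 * r).*2.+1.-tuple 'I_n)
         (switchable S H false j k s)%:R :> R.
  under eq_bigr do rewrite -natr_sum.
  under [in RHS]eq_bigr do rewrite -natr_sum.
  rewrite -!natr_sum; congr _%:R; apply: double_count_switch.
  by rewrite /= odd_double.
have /andP[lo1 hi1] := count true; have /andP[lo0 hi0] := count false.
rewrite same in lo1 hi1.
pose e := (d%:R * D%:R) ^+ (6 * r) / n%:R : R.
have e0 : 0 < e by rewrite divr_gt0// exprn_gt0// mulr_gt0.
have scaleE tau : trail_scale tau = Dg tau * e by rewrite /e mulrA.
rewrite !scaleE in lo1 lo0 hi1 hi0.
have -> : 44 * eps = 4 * (11 * eps) by ring.
apply: edge_ratio => //.
- by rewrite -total ltr0n card_gt0; apply/set0Pn; exists H0.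
- by apply/andP; split; lra.
- rewrite -(ler_pM2r e0).
  have := le_trans lo1 hi0; rewrite /=; lra.
- rewrite -(ler_pM2r e0).
  have := le_trans lo0 hi1; rewrite /=; lra.
Qed.

End FactorEstimate.

Section DegreeRange.
Variables (n : nat) (t : 'I_n -> nat).

Lemma le_vmax i : (t i <= vmax t)%N.
Proof. exact: leq_bigmax. Qed.

Lemma vmin_le i : (vmin t <= t i)%N.
Proof.
rewrite /vmin; elim: index_enum (mem_index_enum i) => // x l IH.
rewrite inE big_cons => /orP[/eqP<-|/IH h]; first exact: geq_minl.
exact: leq_trans (geq_minr _ _) h.
Qed.

Lemma vmax_le_add_vrng i : (vmax t <= t i + vrng t)%N.
Proof. by rewrite /vrng; have := vmin_le i; have := le_vmax i; clear; lia. Qed.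

End DegreeRange.

Lemma const_mx_mul_sum0 (R : realType) n (b : R) (z : 'cV[R]_n) :
  \sum_i z i 0 = 0 -> (const_mx b : 'M[R]_n) *m z = 0.
Proof.
move=> z0; apply/matrixP => i j; rewrite !mxE ord1.
by under eq_bigr do rewrite mxE; rewrite -mulr_sumr z0 mulr0.
Qed.

(** Here L stands for ln n.  Taking r = A (floor L + 1) makes q^r at most exp(-L),
    and keeps 12 r + 2 at most 26 A L, which is where the constant 26 comes from. *)
Lemma factor_edge_probability_log (R : realType) n (S : sgraph n) (t : 'I_n -> nat)
    (c eps delta L b : R) (A : nat) (j k : 'I_n)
    (q := (1 + c) / 2) (D := (gmax S)%:R : R) (d := (vmax t)%:R : R) :
    0 < c < 1 -> 0 < eps <= 24^-1 -> (0 < A)%N -> q ^+ A <= expR (- 1) ->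
    0 < delta -> 4 * (26 * A%:R) ^+ 2 * delta <= eps * (1 - q) ->
    1 <= L -> expR (- L) <= eps / Num.sqrt n%:R ->
    (grng S)%:R <= delta * (D / L) -> (vrng t)%:R <= delta * (d / L) ->
    L ^+ 2 / D <= delta * d -> d <= delta * (D / L) ->
    opnorm2 (adjmx R S - const_mx b) <= c * D ->
    adj S j k -> (exists H, H \in factors S t) ->
  `| unif_pr R (factors S t) (fun H => adj H j k) - d / D | <= 47 * eps * (d / D).
Proof.
move=> /andP[c0 c1] /andP[eps0 eps1] A_gt0 qA delta0 hdelta L1 hL hi ht hlow hup hii a_jk hex.
have degS_le x : (deg S x <= gmax S)%N := le_vmax (deg S) x.
have D1 : (0 < gmax S)%N.
  apply: leq_trans (degS_le j).
  by rewrite degE (bigD1 k)//= a_jk.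
have D0 : 0 < D by rewrite ltr0n.
have L0 : 0 < L by lra.
have d0 : 0 < d.
  have : 0 < L ^+ 2 / D by rewrite divr_gt0 ?exprn_gt0.
  by move=> /lt_le_trans/(_ hlow); rewrite pmulr_rgt0.
set B := 26 * A%:R in hdelta.
have A1 : 1 <= A%:R :> R by rewrite ler1n.
have B1 : 1 <= B by rewrite /B; lra.
have q0 : 0 < q by rewrite /q; lra.
have q1 : 0 < 1 - q by rewrite /q; lra.
have dB : delta <= delta * B by rewrite ler_peMr// ltW.
have dBB : delta * B <= delta * B ^+ 2.
  by rewrite expr2 mulrA ler_peMr// mulr_ge0 ?ltW//; lra.
have eq1 : eps * (1 - q) <= eps by rewrite ler_piMr ?(ltW eps0)//; lra.
have hd4 : 4 * (delta * B ^+ 2) <= eps * (1 - q) by lra.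
have Linv : L^-1 <= 1 by rewrite invf_le1.
have Linv0 : 0 < L^-1 by rewrite invr_gt0.
have d_D : d / D <= delta.
  rewrite ler_pdivrMr//; apply: (le_trans hup).
  by rewrite ler_wpM2l ?(ltW delta0)// ler_piMr// ltW.
have delta_eps : delta <= eps by lra.
pose r := (A * (Num.truncn L).+1)%N.
have /andP[tr1 tr2] := truncn_itv (ltW L0).
have r_le : (12 * r + 2)%:R <= B * L.
  rewrite /r natrD !natrM -natr1 /B.
  have AL : 1 <= A%:R * L by exact: mulr_ege1.
  have : A%:R * ((Num.truncn L)%:R + 1) <= A%:R * (L + L) by rewrite ler_wpM2l//; lra.
  lra.
have BL0 : 0 <= (12 * r + 2)%:R :> R by [].
(* one half for the range of S and one half for the degrees of the factor *)
pose eta := 2 * delta / L.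
have eta0 : 0 <= eta by rewrite divr_ge0 ?mulr_ge0// ltW.
have eta_delta : eta <= 2 * delta by rewrite /eta ler_piMr// mulr_ge0// ltW.
apply: le_trans (factor_edge_probability (c := c) (q := q) (eta := eta) (eps := eps)
  (r := r) _ _ _ _ _ _ _ _ _ _ _ _ _ _ _ _ _ a_jk hex) _.
- by rewrite -(ltr0n R).
- rewrite -(ler_nat R) -/d -/D.
  move: d_D; rewrite ler_pdivrMr// => /le_trans; apply.
  by rewrite ler_piMl ?(ltW D0)//; lra.
- exact: degS_le.
- move=> x; have h := vmax_le_add_vrng (deg S) x.
  have hx : D <= (deg S x)%:R + (grng S)%:R by rewrite -natrD ler_nat.
  have tx : (t x)%:R <= d by rewrite ler_nat le_vmax.
  have -> : (1 - eta) * D = D - 2 * (delta * (D / L)) by rewrite /eta; ring.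
  by rewrite -/D; lra.
- exact: le_vmax.
- move=> x; have h := vmax_le_add_vrng t x.
  have hx : d <= (t x)%:R + (vrng t)%:R by rewrite -natrD ler_nat.
  have -> : (1 - eta) * d = d - 2 * (delta * (d / L)) by rewrite /eta; ring.
  have : 0 <= delta * (d / L) by rewrite !mulr_ge0// ltW.
  lra.
- move=> z z0.
  have -> : adjmx R S *m z = (adjmx R S - const_mx b) *m z.
    by rewrite mulmxBl const_mx_mul_sum0// subr0.
  apply: le_trans (l2norm_mulmx_le _ _) _.
  by rewrite ler_wpM2r ?l2norm_ge0.
- exact: ltW.
- have : delta <= 1 - q.
    have : eps * (1 - q) <= 1 - q by rewrite ler_piMl ?(ltW q1)//; lra.
    lra.
  by rewrite -/d -/D /q; lra.
- by rewrite -subr_gt0.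
- exact: eta0.
- by rewrite (ltW eps0).
- by rewrite muln_gt0 A_gt0.
- apply: le_trans _ hL; rewrite /r exprM.
  apply: (@le_trans _ _ (expR (- 1) ^+ (Num.truncn L).+1)).
    by rewrite ler_pXn2r// nnegrE ?expR_ge0// exprn_ge0// ltW.
  by rewrite -expRM_natl ler_expR mulrN1 lerN2 ltW.
- rewrite ler_pdivrMr//; lra.
- apply: (@le_trans _ _ (B * L * eta)); first by rewrite ler_wpM2r.
  have -> : B * L * eta = 2 * (delta * B) by rewrite /eta; field; rewrite gt_eqF.
  lra.
- apply: (@le_trans _ _ ((B * L) ^+ 2)).
    by rewrite ler_pXn2r// nnegrE (le_trans BL0).
  rewrite exprMn.
  have : L ^+ 2 <= delta * (d * D) by rewrite mulrA -ler_pdivrMr.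
  move=> /(ler_wpM2l (sqr_ge0 B)) h; apply: (le_trans h).
  rewrite (mulrA (B ^+ 2)) -/d -/D; apply: ler_wpM2r; first by rewrite mulr_ge0 ?ltW.
  lra.
- rewrite -/d -/D ler_wpM2r ?divr_ge0 ?ltW//; lra.
Qed.

(** * Asymptotics *)

Local Open Scope classical_set_scope.

Lemma littleo_near_le (R : realType) (f g : R ^nat) (delta : R) :
  f =o_\oo g -> 0 < delta -> (forall n, 0 <= f n) ->
  \forall n \near \oo, 0 <= g n -> f n <= delta * g n.
Proof.
move=> fg delta0 f0; have /eqoP/(_ _ delta0) := fg.
apply: filterS => n; rewrite ger0_norm// => h g0.
by rewrite (ger0_norm g0) in h.
Qed.

Unset Implicit Arguments.
Set Strict Implicit.
Set Printing Implicit Defensive.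

Theorem theorem1p8 (R : realType) (c : R) (hc : 0 < c < 1)
  (S : forall n : nat, sgraph n)
  (hi : (fun n : nat => (grng (S n))%:R : R) =o_\oo
        (fun n : nat => (gmax (S n))%:R / ln (n%:R : R)))
  (hii : \forall n \near \oo,
     opnorm2 (adjmx R (S n)
              - const_mx ((nb_edges (S n))%:R / ('C(n, 2))%:R))
       <= c * (gmax (S n))%:R)
  (hiii : forall delta : R, 0 < delta -> forall eps : R, 0 < eps ->
     \forall n \near \oo, forall x y : 'cV[R]_n,
       (forall i, 0 <= x i 0 <= 1) -> (forall i, 0 <= y i 0 <= 1) ->
       delta * n%:R <= l1norm x -> delta * n%:R <= l1norm y ->
       `| \sum_(j < n) \sum_(k < n | adj (S n) j k) x j 0 * y k 0
          - l1norm x * l1norm y * ((gmax (S n))%:R / n%:R) |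
       <= eps * (l1norm x * l1norm y * ((gmax (S n))%:R / n%:R)))
  (t : forall n : nat, 'I_n -> nat)
  (hfactor : \forall n \near \oo, exists H, H \in factors (S n) (t n))
  (hiv_rng : (fun n : nat => (vrng (t n))%:R : R) =o_\oo
        (fun n : nat => (vmax (t n))%:R / ln (n%:R : R)))
  (hiv_lower : (fun n : nat => ln (n%:R : R) ^+ 2 / (gmax (S n))%:R) =o_\oo
        (fun n : nat => (vmax (t n))%:R : R))
  (hiv_upper : (fun n : nat => (vmax (t n))%:R : R) =o_\oo
        (fun n : nat => (gmax (S n))%:R / ln (n%:R : R))) :
  forall eps : R, 0 < eps ->
    \forall n \near \oo, forall j k : 'I_n, adj (S n) j k ->
      `| unif_pr R (factors (S n) (t n)) (fun H => adj H j k)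
         - (vmax (t n))%:R / (gmax (S n))%:R |
      <= eps * ((vmax (t n))%:R / (gmax (S n))%:R).
Proof.
move=> eps eps0; have /andP[c0 c1] := hc.
pose e := Num.min (eps / 47) 24^-1.
have e0 : 0 < e by rewrite /e lt_min divr_gt0//= invr_gt0.
have e1 : e <= 24^-1 by rewrite /e ge_min lexx orbT.
have e_eps : 47 * e <= eps by rewrite mulrC -ler_pdivlMr// /e ge_min lexx.
pose q := (1 + c) / 2.
have q0 : 0 < q by rewrite /q; lra.
have q1 : q < 1 by rewrite /q; lra.
have [A A_gt0 qA] : exists2 A : nat, (0 < A)%N & q ^+ A <= expR (- 1).
  have q_norm : `|q| < 1 by rewrite ger0_norm// ltW.
  have /cvgrPdist_le/(_ _ (expR_gt0 (- 1))) [M _ hM] := cvg_expr q_norm.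
  exists M.+1 => //; have := hM M.+1 (leqnSn M); rewrite sub0r normrN.
  by rewrite ger0_norm// exprn_ge0// ltW.
(* the smallness required by factor_edge_probability_log, with equality *)
pose delta := e * (1 - q) / (4 * (26 * A%:R) ^+ 2).
have A0 : 0 < A%:R :> R by rewrite ltr0n.
have B0 : 0 < 4 * (26 * A%:R) ^+ 2 :> R by rewrite mulr_gt0// exprn_gt0// mulr_gt0.
have delta0 : 0 < delta by rewrite divr_gt0// mulr_gt0// subr_gt0.
near=> n.
have n_ge : Num.max (expR 1) (e^-1 ^+ 2) <= n%:R :> R.
  by near: n; exact: nbhs_infty_ger.
move: n_ge; rewrite ge_max => /andP[n_ge1 n_ge2] j k a_jk.
have n0 : 0 < n%:R :> R by apply: lt_le_trans n_ge1; exact: expR_gt0.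
have L1 : 1 <= ln (n%:R : R) by rewrite -ler_expR lnK.
have L0 : 0 <= ln (n%:R : R) := le_trans ler01 L1.
have h1 : (grng (S n))%:R <= delta * ((gmax (S n))%:R / ln (n%:R : R)).
  have : 0 <= (gmax (S n))%:R / ln (n%:R : R) by rewrite divr_ge0.
  by near: n; apply: littleo_near_le hi delta0 _.
have h2 : (vrng (t n))%:R <= delta * ((vmax (t n))%:R / ln (n%:R : R)).
  have : 0 <= (vmax (t n))%:R / ln (n%:R : R) by rewrite divr_ge0.
  by near: n; apply: littleo_near_le hiv_rng delta0 _.
have h3 : ln (n%:R : R) ^+ 2 / (gmax (S n))%:R <= delta * (vmax (t n))%:R.
  have : 0 <= (vmax (t n))%:R :> R by [].
  near: n; apply: littleo_near_le hiv_lower delta0 _ => n.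
  by rewrite divr_ge0// sqr_ge0.
have h4 : (vmax (t n))%:R <= delta * ((gmax (S n))%:R / ln (n%:R : R)).
  have : 0 <= (gmax (S n))%:R / ln (n%:R : R) by rewrite divr_ge0.
  by near: n; apply: littleo_near_le hiv_upper delta0 _.
have h5 : exists H, H \in factors (S n) (t n) by near: n.
have h6 : opnorm2 (adjmx R (S n) - const_mx ((nb_edges (S n))%:R / ('C(n, 2))%:R))
    <= c * (gmax (S n))%:R by near: n.
apply: le_trans (factor_edge_probability_log (c := c) (eps := e) (delta := delta)
  (L := ln (n%:R : R)) (A := A) _ _ A_gt0 qA delta0 _ L1 _ h1 h2 h3 h4 h6 a_jk h5) _.
- exact: hc.
- by rewrite e0.
- by rewrite /delta mulrC divfK// gt_eqF.
- rewrite expRN lnK//.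
  have s0 : 0 < Num.sqrt (n%:R : R) by rewrite sqrtr_gt0.
  rewrite -[X in X^-1]sqr_sqrtr ?(ltW n0)// expr2 invfM ler_pM2r ?invr_gt0//.
  rewrite -[leRHS]invrK lef_pV2 ?posrE ?invr_gt0//.
  rewrite -(@ler_pXn2r _ 2)// ?nnegrE ?invr_ge0 ?(ltW e0) ?(ltW s0)//.
  by rewrite sqr_sqrtr.
- by rewrite ler_wpM2r// divr_ge0.
Unshelve. all: by end_near. Qed.
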